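(* For each of the four types $\widetilde{W}/W\in\{\widetilde{C}_n/C_n,\widetilde{B}_n/B_n,\widetilde{B}_n/D_n,\widetilde{D}_n/D_n\}$, the map $w\mapsto\mathcal{A}(w)$ is a bijection from $\widetilde{W}/W$ to the following set of abaci: all balanced flush abaci in types $\widetilde{C}/C$ and $\widetilde{B}/D$; all even balanced flush abaci in types $\widetilde{B}/B$ and $\widetilde{D}/D$.
   Context: Groups. Let $N=2n+1$. A mirrored $\mathbb{Z}$-permutation is a bijection $w:\mathbb{Z}\to\mathbb{Z}$ with $w(i+N)=w(i)+N$ and $w(-i)=-w(i)$ for all $i\in\mathbb{Z}$; it is determined by $(w(1),\dots,w(n))$, and its base window is $[w(1),\dots,w(2n)]$. Under composition these form the affine Coxeter group $\widetilde{C}_n$. Define elements by their images $(w(1),\dots,w(n))$: $s_i=(1,\dots,i-1,i+1,i,i+2,\dots,n)$ for $1\le i\le n-1$; $s_0^C=(-1,2,3,\dots,n)$; $s_0^D=(-2,-1,3,\dots,n)$; $s_n^C=(1,\dots,n-1,n+1)$; $s_n^D=(1,\dots,n-2,n+1,n+2)$. The four types are: - $\widetilde{C}/C$: $\widetilde{W}=\widetilde{C}_n$ is all mirrored $\mathbb{Z}$-permutations, with Coxeter generators $s_0=s_0^C,s_1,\dots,s_{n-1},s_n=s_n^C$ ($n\ge2$). - $\widetilde{B}/B$: $\widetilde{W}=\widetilde{B}_n$ is those with $|\{i\le0:w(i)\ge1\}|$ even, generators $s_0=s_0^D,s_1,\dots,s_{n-1},s_n=s_n^C$ ($n\ge3$).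 - $\widetilde{B}/D$: $\widetilde{W}=\widetilde{B}_n$ is those with $|\{i\le n:w(i)\ge n+1\}|$ even, generators $s_0=s_0^C,s_1,\dots,s_{n-1},s_n=s_n^D$ ($n\ge3$). - $\widetilde{D}/D$: $\widetilde{W}=\widetilde{D}_n$ is those satisfying both parity conditions, generators $s_0=s_0^D,s_1,\dots,s_{n-1},s_n=s_n^D$ ($n\ge4$). $W$ is the parabolic subgroup generated by $s_1,\dots,s_n$, and $\widetilde{W}/W$ denotes the set of minimal length representatives of the cosets $wW$; these are the $w\in\widetilde{W}$ with $w(1)<\cdots<w(n)<w(n+1)$ in types $\widetilde{C}/C,\widetilde{B}/B$, and with $w(1)<\cdots<w(n)<w(n+2)$ in types $\widetilde{B}/D,\widetilde{D}/D$. Abaci. An abacus has $2n$ columns called runners $1,\dots,2n$; runner $i$ has entries labeled $mN+i$ for each level $m\in\mathbb{Z}$ (so the entries are the integers not divisible by $N$). Some entries are circled (beads); the others are gaps. Reading order is the order of the labels; ''lowest'' means largest label. The abacus is flush if no bead is preceded in reading order by a gap on the same runner. It is balanced if every runner has at least one bead and, for all $1\le i\le 2n$, the labels of the lowest beads on runners $i$ and $N-i$ sum to $N$. It is even if the number of gaps preceding $N$ in reading order is even. For a mirrored $\mathbb{Z}$-permutation $w$, $\mathcal{A}(w)$ is the flush abacus whose lowest bead in each runner is an element of $\{w(1),\dots,w(2n)\}$. *)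

(* Defs.v *)
From mathcomp Require Import all_boot all_order all_algebra.
From mathcomp Require Import boolp classical_sets functions cardinality.
From mathcomp Require Import zify.

Set Implicit Arguments.
Unset Strict Implicit.
Unset Printing Implicit Defensive.

Import Order.TTheory GRing.Theory Num.Theory.

Local Open Scope classical_set_scope.
Local Open Scope card_scope.
Local Open Scope ring_scope.

Definition period (n : nat) : int := (n.*2.+1)%:Z.

Definition even_card (A : set int) : Prop :=
  exists2 k : nat, A #= `I_k & ~~ odd k.

Definition mirrored (n : nat) (w : int -> int) : Prop :=
  [/\ bijective w,
      forall i : int, w (i + period n) = w i + period n
    & forall i : int, w (- i) = - w i].

(* The function with images f 1, ..., f n that satisfies the translation and
   sign rules of mirrored permutations; see mirror_extE. For n < r < N the rules
   force w r = N - w (N - r). *)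
Definition mirror_ext (n : nat) (f : int -> int) (x : int) : int :=
  let q := (x %/ period n)%Z in
  let r := (x %% period n)%Z in
  if r == 0 then x
  else if r <= n%:Z then f r + q * period n
  else period n - f (period n - r) + q * period n.

Definition s_mid (n i : nat) : int -> int :=
  mirror_ext n [eta (@id int) with i%:Z |-> i%:Z + 1, i%:Z + 1 |-> i%:Z].
Definition s0C (n : nat) : int -> int :=
  mirror_ext n [eta (@id int) with 1 |-> - 1].
Definition s0D (n : nat) : int -> int :=
  mirror_ext n [eta (@id int) with 1 |-> - 2%:Z, 2%:Z |-> - 1].
Definition snC (n : nat) : int -> int :=
  mirror_ext n [eta (@id int) with n%:Z |-> n%:Z + 1].
Definition snD (n : nat) : int -> int :=
  mirror_ext n
    [eta (@id int) with n%:Z - 1 |-> n%:Z + 1, n%:Z |-> n%:Z + 2%:Z].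

(* The types C~/C, B~/B, B~/D and D~/D. *)
Inductive qtype := CC | BB | BD | DD.

Definition min_rank (X : qtype) : nat :=
  match X with CC => 2 | BB => 3 | BD => 3 | DD => 4 end.

(* Whether s_0, resp. s_n, is the generator of type D. *)
Definition typeD_0 (X : qtype) : bool :=
  match X with BB | DD => true | CC | BD => false end.
Definition typeD_n (X : qtype) : bool :=
  match X with BD | DD => true | CC | BB => false end.

Definition affine_group (X : qtype) (n : nat) : set (int -> int) :=
  [set w | [/\ mirrored n w,
      typeD_0 X -> even_card [set i | i <= 0 /\ 1 <= w i]
    & typeD_n X -> even_card [set i | i <= n%:Z /\ n%:Z + 1 <= w i]]].

Definition gen (X : qtype) (n i : nat) : int -> int :=
  if i == 0%N then (if typeD_0 X then s0D n else s0C n)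
  else if i == n then (if typeD_n X then snD n else snC n)
  else s_mid n i.

Definition word_prod (X : qtype) (n : nat) (e : seq nat) : int -> int :=
  foldr (fun i w => gen X n i \o w) id e.

(* The generators are involutions, so words without inverses suffice. *)
Definition parabolic (X : qtype) (n : nat) : set (int -> int) :=
  [set u | exists2 e : seq nat,
     all (fun i => 1 <= i <= n)%N e & word_prod X n e = u].

Definition has_length (X : qtype) (n : nat) (w : int -> int) (l : nat) : Prop :=
  (exists e : seq nat,
     [/\ all (fun i => i <= n)%N e, word_prod X n e = w & size e = l]) /\
  (forall e : seq nat,
     all (fun i => i <= n)%N e -> word_prod X n e = w -> (l <= size e)%N).

Definition min_coset_reps (X : qtype) (n : nat) : set (int -> int) :=
  [set w | affine_group X n w /\
     exists2 l, has_length X n w l &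
       forall u l', parabolic X n u -> has_length X n (w \o u) l' ->
         (l <= l')%N].

(* An abacus is the set of its beads. *)
Definition entries (n : nat) : set int := [set x | ~~ (period n %| x)%Z].

Definition runner (n i : nat) : set int :=
  [set x | exists m : int, x = m * period n + i%:Z].

Definition is_abacus (n : nat) (A : set int) : Prop := A `<=` entries n.

Definition gaps (n : nat) (A : set int) : set int := entries n `\` A.

Definition flush (n : nat) (A : set int) : Prop :=
  forall (i : nat) (b g : int), (1 <= i <= n.*2)%N ->
    A b -> runner n i b -> gaps n A g -> runner n i g -> ~ (g < b).

Definition lowest_bead (n : nat) (A : set int) (i : nat) (b : int) : Prop :=
  [/\ A b, runner n i b & forall c, A c -> runner n i c -> c <= b].

(* Here n.*2.+1 - i is N - i as a natural number. *)
Definition balanced (n : nat) (A : set int) : Prop :=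
  (forall i : nat, (1 <= i <= n.*2)%N -> exists2 b, A b & runner n i b) /\
  (forall i : nat, (1 <= i <= n.*2)%N -> exists b b',
     [/\ lowest_bead n A i b, lowest_bead n A (n.*2.+1 - i) b'
       & b + b' = period n]).

Definition even_abacus (n : nat) (A : set int) : Prop :=
  even_card [set g | gaps n A g /\ g < period n].

Definition in_window (n : nat) (w : int -> int) (b : int) : Prop :=
  exists2 j : nat, (1 <= j <= n.*2)%N & b = w j%:Z.

Definition abacus_spec (n : nat) (w : int -> int) (A : set int) : Prop :=
  [/\ is_abacus n A, flush n A
    & forall i : nat, (1 <= i <= n.*2)%N ->
        exists2 b, lowest_bead n A i b & in_window n w b].

(* When w is mirrored, exactly one abacus satisfies abacus_spec n w; see
   abacus_ofP and abacus_spec_uniq. *)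
Definition abacus_of (n : nat) (w : int -> int) : set int :=
  xget set0 [set A | abacus_spec n w A].

Definition abaci (X : qtype) (n : nat) : set (set int) :=
  [set A | [/\ is_abacus n A, flush n A, balanced n A
    & match X with BB | DD => even_abacus n A | CC | BD => True end]].

Lemma mirrored_shift (n : nat) (w : int -> int) (m x : int) :
  mirrored n w -> w (m * period n + x) = m * period n + w x.
Proof.
case=> _ wD _.
have wn (k : nat) y : w (k%:Z * period n + y) = k%:Z * period n + w y.
  elim: k y => [|k IH] y; first by rewrite !mul0r !add0r.
  rewrite -addn1 PoszD !mulrDl !mul1r -!addrA (addrC (period n)) IH wD.
  by congr (_ + _); rewrite addrC.
case: m => k; first exact: wn.
rewrite NegzE mulNr; apply: (addrI (k.+1%:Z * period n)).
by rewrite -wn !addrA subrr !add0r.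
Qed.

Lemma mirrored0 (n : nat) (w : int -> int) : mirrored n w -> w 0 = 0.
Proof. by case=> _ _ /(_ 0); rewrite oppr0; move: (w 0) => a; lia. Qed.

Lemma mirror_extE (n : nat) (w f : int -> int) :
  mirrored n w -> (forall j : int, 1 <= j <= n%:Z -> w j = f j) ->
  w = mirror_ext n f.
Proof.
move=> wM wf; have [_ wD wN] := wM; apply/funext => x; rewrite /mirror_ext.
have N0 : 0 < period n by [].
have w0 := mirrored0 wM.
have := divz_eq x (period n); have : 0 <= (x %% period n)%Z < period n.
  by rewrite modz_ge0 ?ltz_pmod // gt_eqF.
move: (x %% _)%Z (x %/ _)%Z => r q /andP[r0 rN] xE.
have -> : w x = q * period n + w r by rewrite xE mirrored_shift.
case: eqP => [r_eq0|/eqP r_neq0]; first by rewrite xE r_eq0 w0.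
case: ifP => rn; first by rewrite wf 1?addrC //; lia.
rewrite [LHS]addrC; congr (_ + _); rewrite -wf; last by rewrite /period in rN *; lia.
by rewrite (addrC (period n) (- r)) wD wN; move: (w r) => a; lia.
Qed.

Lemma window_runner (n : nat) (w : int -> int) (i : nat) :
  mirrored n w -> (1 <= i <= n.*2)%N -> exists2 b, in_window n w b & runner n i b.
Proof.
move=> wM ir; have [[v _ vK] _ wN] := wM.
have w0 := mirrored0 wM.
have N0 : 0 < period n by [].
have := vK i%:Z; rewrite (divz_eq (v i%:Z) (period n)) mirrored_shift //.
have : 0 <= (v i%:Z %% period n)%Z < period n.
  by rewrite modz_ge0 ?ltz_pmod // gt_eqF.
move: (_ %/ _)%Z (_ %% _)%Z => q [r|r] // /andP[_ rN] wr.
have r0 : r != 0%N.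
  apply/eqP => r0; move: wr; rewrite r0 w0 addr0 => qi.
  have : (period n %| i%:Z)%Z by rewrite -qi dvdz_mull.
  by rewrite /period /dvdz /= => /dvdn_leq; lia.
exists (w r); first by exists r => //; rewrite /period in rN; lia.
by exists (- q); rewrite -wr mulNr addKr.
Qed.

Lemma window_inj (n : nat) (w : int -> int) (i : nat) (b c : int) :
  mirrored n w -> in_window n w b -> in_window n w c ->
  runner n i b -> runner n i c -> b = c.
Proof.
move=> wM [j jr ->] [k kr ->] [m bE] [p cE].
have [/bij_inj w_inj _ _] := wM.
have : w j%:Z = w ((m - p) * period n + k%:Z).
  by rewrite mirrored_shift // bE cE mulrBl addrA subrK.
move=> /w_inj jE; suff -> : j = k by [].
have : m - p = 0 by rewrite /period in jE; nia.
by move=> mp0; move: jE; rewrite mp0 mul0r add0r => -[].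
Qed.

Lemma entry_runner (n : nat) (x : int) :
  entries n x <-> exists2 i : nat, (1 <= i <= n.*2)%N & runner n i x.
Proof.
have N0 : 0 < period n by [].
split=> [|[i ir [m xE]]].
  rewrite /entries /= -(rwP negP) => Nx.
  have : 0 <= (x %% period n)%Z < period n.
    by rewrite modz_ge0 ?ltz_pmod // gt_eqF.
  move: (divz_eq x (period n)) Nx; move: (_ %/ _)%Z (_ %% _)%Z => q [r|r] // xE.
  move=> Nx /andP[_ rN]; exists r; last by exists q.
  suff : r != 0%N by rewrite /period in rN; lia.
  by apply/eqP => r0; apply: Nx; rewrite xE r0 addr0 dvdz_mull.
rewrite /entries /= xE rpredDl ?dvdz_mull //.
by apply/negP; rewrite /period /dvdz /= => /dvdn_leq; lia.
Qed.

Lemma abacus_spec_uniq (n : nat) (w : int -> int) (A B : set int) :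
  mirrored n w -> abacus_spec n w A -> abacus_spec n w B -> A = B.
Proof.
move=> wM; suff sub C D : abacus_spec n w C -> abacus_spec n w D -> C `<=` D.
  by move=> sA sB; apply/seteqP; split; apply: sub.
move=> [Ce _ Cl] [De Df Dl] x Cx; have [i ir xi] := (entry_runner n x).1 (Ce x Cx).
have [b [_ bi bmax] bw] := Cl i ir; have [c [Dc ci _] cw] := Dl i ir.
have bc := window_inj wM bw cw bi ci; apply: contrapT => Dx.
apply: (Df i c x) => //; first by split=> //; apply: Ce.
rewrite lt_neqAle -bc bmax // andbT; apply/eqP => xb.
by apply: Dx; rewrite xb bc.
Qed.

Lemma abacus_ofP (n : nat) (w : int -> int) :
  mirrored n w -> abacus_spec n w (abacus_of n w).
Proof.
move=> wM.
suff : abacus_spec n w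
    [set x | exists i : nat, [/\ (1 <= i <= n.*2)%N, runner n i x
                             & exists b, [/\ in_window n w b, runner n i b & x <= b]]].
  exact: xgetI.
have same i j x : (1 <= i <= n.*2)%N -> (1 <= j <= n.*2)%N ->
    runner n i x -> runner n j x -> i = j.
  move=> ir jr [m xi] [p xj]; have : (m - p) * period n = j%:Z - i%:Z by lia.
  rewrite /period => E; have : m - p = 0 by nia.
  by move=> mp; move: E; rewrite mp mul0r; lia.
split.
- by move=> x [i [ir xi _]]; apply/entry_runner; exists i.
- move=> i b g ir [j [jr bj [c [cw cj bc]]]] bi [_ Ng] gi gb; apply: Ng.
  exists i; split=> //; exists c; split=> //; last exact: le_trans (ltW gb) bc.
  by rewrite (same i j b).
- move=> i ir; have [b bw bi] := window_runner wM ir; exists b => //.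
  split=> //; first by exists i; split=> //; exists b.
  move=> c [j [jr cj [d [dw dj cd]]]] ci.
  rewrite (window_inj wM bw dw bi) //.
  by rewrite (same i j c).
Qed.

(* Main.v *)
(* Each generator s_i is the reflection exchanging the two entries of a simple
   pair (p_i, q_i), and w has a descent at i when w(q_i) < w(p_i). A generator
   inverts no root but its own simple pair, which gives the exchange property:
   a word with a descent at i can be shortened by multiplying by s_i. Since
   the sum of the (w(j) - j)^2 drops at each descent, the generators generate the
   group, and every coset wW contains an element without descents at 1, ..., n.
   Such an element is determined by its window {w(1), ..., w(2n)}, up to the
   reflection at n + 1/2, which parity decides in type D; hence it is the one of
   minimal length. The window is the set of lowest beads of the abacus, and the
   gaps before N correspond to the i <= 0 with w(i) >= 1, through i |-> w(N - i). *)
Require Import Defs.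
From mathcomp Require Import all_boot all_order all_algebra.
From mathcomp Require Import boolp classical_sets functions cardinality.
From mathcomp Require Import finmap zify.

Set Implicit Arguments.
Unset Strict Implicit.
Unset Printing Implicit Defensive.

Import Order.TTheory GRing.Theory Num.Theory.

Local Open Scope classical_set_scope.
Local Open Scope card_scope.
Local Open Scope ring_scope.

(** * Reflections and generators *)

Lemma periodE (n : nat) : period n = n%:Z + n%:Z + 1.
Proof. by rewrite /period; lia. Qed.

(** Turns a congruence modulo the period into three equations, which [lia] can then decide. *)
Lemma dvd_period_small (n : nat) (z : int) :
  - (period n + period n) < z < period n + period n ->
  (period n %| z)%Z = [|| z == - period n, z == 0 | z == period n].
Proof.
rewrite periodE => zb; apply/dvdzP/idP => [[k zE]|].
  have k1 : -2 < k by nia.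
  have k2 : k < 2 by nia.
  have : k = -1 \/ k = 0 \/ k = 1 by lia.
  by case=> [kE|[kE|kE]]; rewrite kE in zE; lia.
by case/or3P => /eqP ->; [exists (-1)|exists 0|exists 1]; lia.
Qed.

(** The period is odd, hence coprime to 2. *)
Lemma dvd_period_double (n : nat) (z : int) :
  (period n %| z + z)%Z = (period n %| z)%Z.
Proof.
rewrite -[z + z]mulr2n -mulr_natl Gauss_dvdzr // /coprimez /gcdz /=.
by rewrite /period /= gcdnC -[_ == _]/(coprime _ _) coprime2n /= odd_double.
Qed.

Lemma mirroredB (n : nat) (w : int -> int) (m x : int) :
  mirrored n w -> w (m * period n - x) = m * period n - w x.
Proof. by move=> wM; rewrite mirrored_shift //; case: wM => _ _ ->. Qed.

Lemma mirrored_inj (n : nat) (w : int -> int) : mirrored n w -> injective w.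
Proof. by case=> /bij_inj. Qed.

Lemma mirrored_comp (n : nat) (w u : int -> int) :
  mirrored n w -> mirrored n u -> mirrored n (w \o u).
Proof.
move=> [wb wD wN] [ub uD uN]; split=> [|i|i] /=; first exact: bij_comp.
  by rewrite uD wD.
by rewrite uN wN.
Qed.

Lemma mirrored_id (n : nat) : mirrored n id.
Proof. by split=> //; exists id. Qed.

Lemma dvd_mirroredB (n : nat) (w : int -> int) (x y : int) :
  mirrored n w -> (period n %| w x - w y)%Z = (period n %| x - y)%Z.
Proof.
move=> wM; have wI := mirrored_inj wM.
apply/dvdzP/dvdzP => -[k E]; exists k.
  suff : x = k * period n + y by move->; rewrite addrK.
  by apply: wI; rewrite mirrored_shift // -E subrK.
by rewrite -(subrK y x) E mirrored_shift // addrK.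
Qed.

Lemma dvd_mirroredD (n : nat) (w : int -> int) (x y : int) :
  mirrored n w -> (period n %| w x + w y)%Z = (period n %| x + y)%Z.
Proof.
move=> wM; rewrite -[y in RHS]opprK -(dvd_mirroredB _ _ wM).
by case: wM => _ _ ->; rewrite opprK.
Qed.

Lemma dvd_mirrored (n : nat) (w : int -> int) (x : int) :
  mirrored n w -> (period n %| w x)%Z = (period n %| x)%Z.
Proof.
by move=> wM; rewrite -[x in RHS]subr0 -(dvd_mirroredB _ _ wM) (mirrored0 wM) subr0.
Qed.

(* A reflection only when nondegenerate n a b holds. *)
Definition refl (n : nat) (a b x : int) : int :=
  if (period n %| x - a)%Z || (period n %| x + b)%Z then x + (b - a)
  else if (period n %| x - b)%Z || (period n %| x + a)%Z then x - (b - a)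
  else x.

Definition nondegenerate (n : nat) (a b : int) : bool :=
  [&& ~~ (period n %| a)%Z, ~~ (period n %| b)%Z & ~~ (period n %| b - a)%Z].

(** Subtracting the two multiples of the period would make it divide [b - a], [2a] or [2b]; it is
    odd, so nondegeneracy forbids all three. That the branches of [refl] exclude each other makes it
    an odd involution. *)
Lemma refl_excl (n : nat) (a b x : int) : nondegenerate n a b ->
  (period n %| x - a)%Z || (period n %| x + b)%Z ->
  (period n %| x - b)%Z || (period n %| x + a)%Z -> False.
Proof.
move=> /and3P[Na Nb Nab].
case/orP=> d1 /orP[] d2; have := rpredB d1 d2.
- have -> : x - a - (x - b) = b - a by lia.
  by rewrite (negbTE Nab).
- have -> : x - a - (x + a) = - (a + a) by lia.
  by rewrite rpredN dvd_period_double (negbTE Na).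
- have -> : x + b - (x - b) = b + b by lia.
  by rewrite dvd_period_double (negbTE Nb).
- have -> : x + b - (x + a) = b - a by lia.
  by rewrite (negbTE Nab).
Qed.

Lemma refl_l (n : nat) (a b : int) : refl n a b a = b.
Proof. by rewrite /refl subrr dvdz0 /= addrC subrK. Qed.

Lemma refl_r (n : nat) (a b : int) : nondegenerate n a b -> refl n a b b = a.
Proof.
move=> nd; rewrite /refl; case: ifP => [/(refl_excl nd)[]|_].
  by rewrite subrr dvdz0.
by rewrite subrr dvdz0 /= opprB addrC subrK.
Qed.

Lemma reflD (n : nat) (a b x : int) : refl n a b (x + period n) = refl n a b x + period n.
Proof.
have d y : (period n %| x + period n + y)%Z = (period n %| x + y)%Z.
  by rewrite addrAC rpredDr // dvdzz.
by rewrite /refl !d; do 2![case: ifP => _; first by rewrite addrAC].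
Qed.

Lemma reflN (n : nat) (a b x : int) : nondegenerate n a b ->
  refl n a b (- x) = - refl n a b x.
Proof.
move=> nd; rewrite /refl.
have dN y : (period n %| - x + y)%Z = (period n %| x - y)%Z.
  by rewrite -[- x + y]opprK rpredN opprD opprK.
rewrite !dN !opprK (orbC (_ %| x + a)%Z) (orbC (_ %| x + b)%Z).
case: (boolP (_ || _)) => c1; case: (boolP (_ || _)) => c2 //=; try lia.
by case: (refl_excl nd c2 c1).
Qed.

Lemma reflK (n : nat) (a b : int) : nondegenerate n a b ->
  involutive (refl n a b).
Proof.
move=> nd x; rewrite {2}/refl; case: ifP => c1; last case: ifP => c2.
- have c : (period n %| x + (b - a) - b)%Z || (period n %| x + (b - a) + a)%Z.
    have -> : x + (b - a) - b = x - a by lia.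
    by have -> : x + (b - a) + a = x + b by lia.
  rewrite /refl; case: ifP => [/(refl_excl nd)/(_ c) []|_].
  by rewrite c addrK.
- have c : (period n %| x - (b - a) - a)%Z || (period n %| x - (b - a) + b)%Z.
    have -> : x - (b - a) - a = x - b by lia.
    by have -> : x - (b - a) + b = x + a by lia.
  by rewrite /refl c subrK.
- by rewrite /refl c1 c2.
Qed.

Lemma mirrored_refl (n : nat) (a b : int) : nondegenerate n a b ->
  mirrored n (refl n a b).
Proof.
move=> nd; split; first by exists (refl n a b); exact: reflK.
- exact: reflD.
- by move=> i; apply: reflN.
Qed.

(** Since [w] preserves and reflects divisibility of sums and differences by the period, both sides
    take the same branch of [refl] at each point. *)
Lemma mirrored_refl_conj (n : nat) (w : int -> int) (a b : int) :
  mirrored n w -> w \o refl n a b = refl n (w a) (w b) \o w.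
Proof.
move=> wM; have wN : forall i, w (- i) = - w i by case: wM.
apply/funext => x /=; rewrite /refl !dvd_mirroredB // !dvd_mirroredD //.
case: ifP => [/orP[] /dvdzP[k E]|_].
- have -> : x = k * period n + a by lia.
  have -> : k * period n + a + (b - a) = k * period n + b by lia.
  by rewrite !mirrored_shift //; lia.
- have -> : x = k * period n - b by lia.
  have -> : k * period n - b + (b - a) = k * period n - a by lia.
  by rewrite !mirroredB //; lia.
case: ifP => [/orP[] /dvdzP[k E]|_] //.
- have -> : x = k * period n + b by lia.
  have -> : k * period n + b - (b - a) = k * period n + a by lia.
  by rewrite !mirrored_shift //; lia.
- have -> : x = k * period n - a by lia.
  have -> : k * period n - a - (b - a) = k * period n - b by lia.
  by rewrite !mirroredB //; lia.
Qed.

(** The reflection in [(a, b)] is also the one in its translates by multiples of the period and in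
    those of its mirror image [(- b, - a)]. *)
Lemma refl_same (n : nat) (a b x y : int) :
  y - x = b - a -> (period n %| x - a)%Z \/ (period n %| x + b)%Z ->
  refl n x y = refl n a b.
Proof.
move=> xy xa; apply/funext => t; rewrite /refl xy.
case: xa => xa.
  have -> : t - x = t - a - (x - a) by lia.
  have -> : t + y = t + b + (x - a) by lia.
  have -> : t - y = t - b - (x - a) by lia.
  have -> : t + x = t + a + (x - a) by lia.
  by rewrite !(rpredBr _ xa) !(rpredDr _ xa).
have -> : t - x = t + b - (x + b) by lia.
have -> : t + y = t - a + (x + b) by lia.
have -> : t - y = t + a - (x + b) by lia.
have -> : t + x = t - b + (x + b) by lia.
by rewrite !(rpredBr _ xa) !(rpredDr _ xa) (orbC (_ %| t + b)%Z) (orbC (_ %| t + a)%Z).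
Qed.

Ltac window_cases :=
  rewrite /refl ?dvd_period_small;
  repeat (case: ifP => [/orP[]/or3P[]/eqP ?|/norP[/norP[? /norP[? ?]] /norP[? /norP[? ?]]]]);
  repeat (case: ifP => ?); lia.

(** Exchanging -1 and 2 also exchanges -2 and 1, which gives [s0D]; exchanging [n] and [n + 2] also
    exchanges [n + 1] and [n - 1], which gives [snD]. The smaller entry comes first, so a descent is
    an inversion of the pair. *)
Definition simple_pair (X : qtype) (n i : nat) : int * int :=
  if i == 0%N then (- 1, if typeD_0 X then 2 else 1)
  else if i == n then (n%:Z, n%:Z + (if typeD_n X then 2 else 1))
  else (i%:Z, i%:Z + 1).

(** [refl_0] and [refl_n] are the end generators of type C whatever the type [X]. In type D they
    serve to flip one parity while keeping the other. *)
Definition refl_0 (n : nat) : int -> int := refl n (- 1) 1.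
Definition refl_n (n : nat) : int -> int := refl n n%:Z (n%:Z + 1).
Definition refl_mid (n i : nat) : int -> int := refl n i%:Z (i%:Z + 1).

Lemma min_rank_typeD (X : qtype) (n : nat) : (min_rank X <= n)%N ->
  [/\ (1 < n)%N, typeD_0 X -> (2 < n)%N, typeD_n X -> (2 < n)%N
    & typeD_0 X -> typeD_n X -> (3 < n)%N].
Proof. by case: X => /= h; split=> // *; lia. Qed.

Lemma simple_pair_nondegenerate (X : qtype) (n i : nat) :
  (min_rank X <= n)%N -> (i <= n)%N ->
  nondegenerate n (simple_pair X n i).1 (simple_pair X n i).2.
Proof.
move=> /min_rank_typeD[n1 D0 Dn _] ilen.
rewrite /nondegenerate /simple_pair; have pE := periodE n.
case: eqP => [_|/eqP i0]; last case: eqP => [_|/eqP jn] /=.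
- by case: (typeD_0 X) => /=; rewrite !dvd_period_small; lia.
- by case: (typeD_n X) Dn => [/(_ isT)|_] /=; rewrite !dvd_period_small; lia.
- by rewrite !dvd_period_small; lia.
Qed.

Lemma refl_n_nondegenerate (n : nat) : (0 < n)%N -> nondegenerate n n%:Z (n%:Z + 1).
Proof.
by move=> n0; have pE := periodE n; rewrite /nondegenerate !dvd_period_small; lia.
Qed.

Lemma refl_0_nondegenerate (n : nat) : (0 < n)%N -> nondegenerate n (- 1) 1.
Proof.
by move=> n0; have pE := periodE n; rewrite /nondegenerate !dvd_period_small; lia.
Qed.

Lemma refl_mid_nondegenerate (n i : nat) :
  (0 < i < n)%N -> nondegenerate n i%:Z (i%:Z + 1).
Proof.
by move=> ir; have pE := periodE n; rewrite /nondegenerate !dvd_period_small; lia.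
Qed.

(** The reflection is mirrored, so by [mirror_extE] its values at 1, ..., [n] suffice. *)
Lemma genE (X : qtype) (n i : nat) : (min_rank X <= n)%N -> (i <= n)%N ->
  gen X n i = refl n (simple_pair X n i).1 (simple_pair X n i).2.
Proof.
move=> hn ilen; have rM := mirrored_refl (simple_pair_nondegenerate hn ilen).
have pE := periodE n; have [n1 D0 Dn D0n] := min_rank_typeD hn.
move: rM; rewrite /gen /simple_pair /s0D /s0C /snD /snC /s_mid.
case: eqP => [_|/eqP i0]; last case: eqP => [_|/eqP jn] /=.
- by case: (typeD_0 X) D0 => /= [/(_ isT) n2|_] rM; symmetry;
    apply: mirror_extE => // j jr /=; window_cases.
- by case: (typeD_n X) Dn => /= [/(_ isT) n2|_] rM; symmetry;
    apply: mirror_extE => // j jr /=; window_cases.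
- by move=> rM; symmetry; apply: mirror_extE => // j jr /=; window_cases.
Qed.

(** * Pairs inverted by a generator *)

(* In type D at 0 (resp. at n) the group contains no reflection exchanging a and
   b when a + b is 0 (resp. N) modulo 2N. *)
Definition is_root (X : qtype) (n : nat) (a b : int) : Prop :=
  [/\ ~~ (period n %| a)%Z, ~~ (period n %| b)%Z,
      typeD_0 X -> forall c : int, a + b <> (c + c) * period n
    & typeD_n X -> forall c : int, a + b <> (c + c + 1) * period n].

(** If [w a + w b] is [c] times the period, so is [a + b] with the same [c]; hence the parity of [c]
    is respected too. *)
Lemma is_root_mirrored (X : qtype) (n : nat) (w : int -> int) (a b : int) :
  mirrored n w -> is_root X n a b -> is_root X n (w a) (w b).
Proof.
move=> wM [Na Nb D0 Dn]; have wI := mirrored_inj wM.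
have sumE c : w a + w b = c * period n -> a + b = c * period n.
  move=> E; suff : a = c * period n - b by move->; rewrite subrK.
  by apply: wI; rewrite mirroredB //; lia.
by split; rewrite ?dvd_mirrored // => D c /sumE; [exact: D0|exact: Dn].
Qed.

Lemma simple_pair_root (X : qtype) (n i : nat) :
  (min_rank X <= n)%N -> (i <= n)%N ->
  is_root X n (simple_pair X n i).1 (simple_pair X n i).2.
Proof.
move=> hn ilen; have /and3P[Na Nb _] := simple_pair_nondegenerate hn ilen.
have pE := periodE n; have [n1 D0 Dn _] := min_rank_typeD hn.
(* These two bounds settle every simple pair, except for the odd multiples at [n] in type D, where
   the sum is [period n + 1]. *)
have even_bound c z : 0 < z < 2 * period n -> z <> (c + c) * period n.
  by have [c0|c1] := leP c 0; nia.
have odd_bound c z : - period n < z < period n -> z <> (c + c + 1) * period n.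
  by have [c0|c1] := leP 0 c; nia.
split=> // {Na Nb} D c; move: D; rewrite /simple_pair;
  (case: eqP => [_|/eqP i0] /=; last case: eqP => [_|/eqP jn] /=).
- by move=> /[dup] /D0 ? ->; apply: even_bound; lia.
- by case: (typeD_n X) Dn => [/(_ isT)|_] *; apply: even_bound; lia.
- by move=> _; apply: even_bound; lia.
- by case: (typeD_0 X) D0 => [/(_ isT)|_] *; apply: odd_bound; lia.
- move=> /[dup] /Dn ? ->.
  have -> : n%:Z + (n%:Z + 2) = period n + 1 by lia.
  have [c0|c1] := leP c 0; last by nia.
  by have [->|c0'] := eqVneq c 0; nia.
- by move=> _; apply: odd_bound; lia.
Qed.

Lemma simple_pair_lt (X : qtype) (n i : nat) :
  (simple_pair X n i).1 < (simple_pair X n i).2.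
Proof.
rewrite /simple_pair; case: ifP => _ /=; first by case: (typeD_0 X); lia.
by case: ifP => _ /=; first case: (typeD_n X); lia.
Qed.

Lemma refl_bound (n : nat) (a b x : int) : a < b ->
  x - (b - a) <= refl n a b x <= x + (b - a).
Proof. by move=> ab; rewrite /refl; do 2?[case: ifP => _]; lia. Qed.

Lemma reflDr (n : nat) (a b k x : int) : nondegenerate n a b ->
  refl n a b (k * period n + x) = k * period n + refl n a b x.
Proof. by move=> nd; apply: mirrored_shift; apply: mirrored_refl. Qed.

Ltac dvd_cases not_up not_down :=
  rewrite /refl !dvd_period_small; try lia;
  case: ifP => [/orP[]/or3P[]/eqP ?|]; [lia..|move=> not_up];
  case: ifP => [/orP[]/or3P[]/eqP ?|]; [(clear not_up; lia)..|move=> not_down].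

(** A reflection moves points by at most [q - p], so [y] lies strictly between [x] and
    [x + 2(q - p)], which leaves at most five integers. Among them, [is_root] removes those inverted
    by accident: the multiples of the period and, in type D, the mirror image of [x]. *)
Lemma simple_refl_inversion_up (X : qtype) (n i : nat) (x y : int) :
  let p := (simple_pair X n i).1 in let q := (simple_pair X n i).2 in
  (min_rank X <= n)%N -> (i <= n)%N -> is_root X n x y ->
  x = p \/ x = - q ->
  x < y -> refl n p q y < x + (q - p) -> y = x + (q - p).
Proof.
move=> p q hn ilen [_ Ny D0 Dn] xp xy ryx.
have pq : p < q := simple_pair_lt X n i.
have yx : y < x + (q - p) + (q - p) by have := refl_bound n y pq; lia.
have pE := periodE n.
have y0 : y != 0 by apply: contraNneq Ny => ->; rewrite dvdz0.
have yN : y != - period n by apply: contraNneq Ny => ->; rewrite rpredN.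
have {}D0 : typeD_0 X -> x + y <> 0 by move=> /D0/(_ 0); rewrite mul0r.
have {}Dn : typeD_n X -> x + y <> period n /\ x + y <> - period n.
  by move=> /Dn D; split; [have := D 0|have := D (-1)]; lia.
have {Ny} [n1 D0n Dnn _] := min_rank_typeD hn.
move: xp yx ryx; rewrite /p /q {p q pq hn} /simple_pair.
case: eqP => [_|/eqP i0] /=; last case: eqP => [_|/eqP jn] /=.
- case: (typeD_0 X) D0 D0n => [/(_ isT) D0 /(_ isT) D0n|_ _] [] xE yx; subst x;
    dvd_cases not_up not_down; try (by clear not_up not_down; lia).
  by clear not_down; lia.
- case: (typeD_n X) Dn Dnn => [/(_ isT) [Dn1 Dn2] /(_ isT) Dnn|_ _]; last by lia.
  by case=> xE yx; subst x; dvd_cases not_up not_down; clear not_down; lia.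
- by lia.
Qed.

Lemma is_root_shift (X : qtype) (n : nat) (k a b : int) :
  is_root X n a b -> is_root X n (k * period n + a) (k * period n + b).
Proof.
have dk : (period n %| k * period n)%Z by rewrite dvdz_mull.
move=> [Na Nb D0 Dn]; split; rewrite ?(rpredDr _ dk) ?(rpredDl _ dk) //.
- by move=> /D0 D c E; apply: (D (c - k)); lia.
- by move=> /Dn D c E; apply: (D (c - k)); lia.
Qed.

Lemma is_root_opp (X : qtype) (n : nat) (a b : int) :
  is_root X n a b -> is_root X n (- b) (- a).
Proof.
move=> [Na Nb D0 Dn]; split; rewrite ?rpredN //.
- by move=> /D0 D c E; apply: (D (- c)); lia.
- by move=> /Dn D c E; apply: (D (- c - 1)); lia.
Qed.

(** For the pair to be inverted, [x] must be raised or [y] lowered. The symmetry taking [(x, y)] to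
    [(- y, - x)] turns the second case into the first, and a translation then brings the raised
    entry to [p] or [- q]. *)
Lemma simple_refl_inversion (X : qtype) (n i : nat) (x y : int) :
  let p := (simple_pair X n i).1 in let q := (simple_pair X n i).2 in
  (min_rank X <= n)%N -> (i <= n)%N -> is_root X n x y ->
  x < y -> refl n p q y < refl n p q x ->
  y - x = q - p /\ ((period n %| x - p)%Z \/ (period n %| x + q)%Z).
Proof.
move=> p q hn ilen.
have nd : nondegenerate n p q := simple_pair_nondegenerate hn ilen.
have pq : p < q := simple_pair_lt X n i.
have up u v : is_root X n u v -> u < v -> refl n p q v < u + (q - p) ->
    (period n %| u - p)%Z || (period n %| u + q)%Z ->
    v - u = q - p /\ ((period n %| u - p)%Z \/ (period n %| u + q)%Z).
  move=> uv ltuv lt c; split; last exact/orP.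
  have [k ku] : exists k, k * period n + u = p \/ k * period n + u = - q.
    by case/orP: c => /dvdzP[k E]; exists (- k); [left|right]; lia.
  have := simple_refl_inversion_up hn ilen (is_root_shift k uv) ku.
  rewrite reflDr // -/p -/q => H; suff : k * period n + v = k * period n + u + (q - p) by lia.
  by apply: H; lia.
clearbody p q; move=> xy ltxy lt.
have [cx|cx] := boolP ((period n %| x - p)%Z || (period n %| x + q)%Z).
  by apply: up => //; move: lt; rewrite [refl n p q x]/refl cx.
have rx : refl n p q x <= x by rewrite /refl (negbTE cx); case: ifP => _; lia.
have [ry cy] : refl n p q y = y - (q - p) /\
    ((period n %| y - q)%Z || (period n %| y + p)%Z).
  move: lt; rewrite [refl n p q y]/refl.
  case: ifP => _; first by move=> {}lt; exfalso; clear -ltxy lt rx pq; lia.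
  case: (boolP (_ || _)) => // _ {}lt; exfalso; clear -ltxy lt rx; lia.
have [] := up (- y) (- x) (is_root_opp xy); rewrite ?reflN //.
- by clear -ltxy; lia.
- by clear -lt ry; lia.
- have -> : - y - p = - (y + p) by clear; lia.
  have -> : - y + q = - (y - q) by clear; lia.
  by rewrite !rpredN orbC.
- move=> yx; have {}yx : y - x = q - p by clear -yx; lia.
  move=> c; split=> //; move: c.
  have -> : x - p = - (- y + q) by clear -yx; lia.
  have -> : x + q = - (- y - p) by clear -yx; lia.
  by rewrite !rpredN or_comm.
Qed.

(** * Parity of crossings *)

Lemma even_card_fset (A : set int) : finite_set A ->
  even_card A <-> ~~ odd #|` fset_set A|%fset.
Proof.
move=> /finite_setP[k Ak]; have cE := card_fset_set Ak; rewrite cE.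
split=> [[m Am]|]; last by exists k.
by rewrite -cE (card_fset_set Am).
Qed.

Lemma even_cardU1 (A : set int) (x : int) : finite_set A -> ~ A x ->
  even_card (x |` A) <-> ~ even_card A.
Proof.
move=> finA Ax; rewrite !even_card_fset //; last by rewrite finite_setU.
rewrite fset_setU1 // cardfsU1 in_fset_set // (_ : x \in A = false) /=.
  by case: odd; split.
by apply: memNset.
Qed.

Lemma even_card_image (A : set int) (f : int -> int) : injective f ->
  even_card (f @` A) <-> even_card A.
Proof.
move=> fI; have fA : f @` A #= A by apply: inj_card_eq => x y _ _ /fI.
by split=> -[k Ak k_even]; exists k => //; rewrite (card_eql fA) in Ak *.
Qed.

Definition crossings (c : int) (w : int -> int) : set int :=
  [set i | i <= c /\ c + 1 <= w i].

(** The difference [w i - i] is periodic, so the sum of its absolute values over one period bounds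
    it. *)
Lemma mirrored_bound (n : nat) (w : int -> int) : mirrored n w ->
  exists M : nat, forall i : int, w i <= i + M%:Z.
Proof.
move=> wM; exists (\sum_(j < n.*2.+1) `|w j%:Z - j%:Z|)%N => i.
have := divz_eq i (period n); have : 0 <= (i %% period n)%Z < period n.
  by rewrite modz_ge0 ?ltz_pmod // gt_eqF.
move: (i %% _)%Z (i %/ _)%Z => [r|r] q // r0 ->.
rewrite mirrored_shift // -addrA lerD2l.
have rN : (r < n.*2.+1)%N by move: r0; rewrite /period; lia.
rewrite (bigD1 (Ordinal rN)) //=; move: (\sum_(_ < _ | _) _)%N => s; lia.
Qed.

Lemma finite_crossings (n : nat) (w : int -> int) (c : int) : mirrored n w ->
  finite_set (crossings c w).
Proof.
move=> /mirrored_bound[M wb].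
apply: (@sub_finite_set _ _ [set c - k%:Z | k in `I_M]).
  move=> i [ic cw]; have := wb i => wi; exists `|c - i|%N => /=; lia.
by apply: finite_image; apply: finite_II.
Qed.

(** An [s] that preserves the half line up to [c] carries the crossings of [w] onto those of
    [w \o s]. *)
Lemma even_crossings_comp (c : int) (w s : int -> int) : involutive s ->
  (forall i, (s i <= c) = (i <= c)) ->
  even_card (crossings c (w \o s)) <-> even_card (crossings c w).
Proof.
move=> sK sc; have sI := inv_inj sK.
rewrite -(even_card_image (crossings c w) sI).
suff -> : crossings c (w \o s) = s @` crossings c w by [].
apply/seteqP; split=> [i [ic wi]|_ [i [ic wi] <-]].
  by exists (s i); [split; rewrite ?sc|rewrite sK].
by split; rewrite /= ?sc ?sK.
Qed.

(** Pulled back by [s], the crossings of [w \o s] form the set [J], which differs from the crossings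
    of [w] in one point: it lacks [a] if [w a] exceeds [c], and has [b] in addition otherwise. *)
Lemma even_crossings_flip (n : nat) (c : int) (w s : int -> int) (a b : int) :
  mirrored n w -> mirrored n s -> involutive s -> s a = b -> a <= c < b ->
  (forall i, i != a -> i != b -> (s i <= c) = (i <= c)) ->
  (c + 1 <= w a) = (w b <= c) ->
  even_card (crossings c (w \o s)) <-> ~ even_card (crossings c w).
Proof.
move=> wM sM sK sa /andP[ac cb] sc wab; have sI := inv_inj sK.
have sb : s b = a by rewrite -sa sK.
pose J := [set i | s i <= c /\ c + 1 <= w i].
have JE : crossings c (w \o s) = s @` J.
  apply/seteqP; split=> [i [ic wi]|_ [i [ic wi] <-]].
    by exists (s i); [split; rewrite ?sK|rewrite sK].
  by split; rewrite /= ?sK.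
have finI := finite_crossings c wM.
have finJ : finite_set J.
  apply: sub_finite_set (finite_image s (finite_crossings c (mirrored_comp wM sM))).
  by move=> i [ic wi]; exists (s i); [split; rewrite /= ?sK|rewrite sK].
rewrite JE even_card_image //.
have Ib : ~ crossings c w b by case; lia.
have Ja : ~ J a by case; rewrite sa; lia.
have [wa|wa] := boolP (c + 1 <= w a).
  suff -> : crossings c w = a |` J.
    rewrite even_cardU1 //.
    by split=> [?|/contrapT]; [apply|].
  apply/seteqP; split=> [i [ic wi]|i [->|[ic wi]]]; last 2 first.
  - by [].
  - have [ia|ia] := eqVneq i a; first by rewrite ia.
    have ib : i != b by apply/eqP => ib; move: wi; rewrite ib; lia.
    by split=> //; rewrite -sc.
  have [ia|ia] := eqVneq i a; [by left|right; split=> //].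
  by rewrite sc //; apply/eqP => ib; move: ic; lia.
suff -> : J = b |` crossings c w by exact: even_cardU1.
have {}wa : w b <= c = false by rewrite -wab; exact: negbTE.
apply/seteqP; split=> [i [ic wi]|i [->|[ic wi]]]; last 2 first.
- by split; [rewrite sb|lia].
- have [ia|ia] := eqVneq i a; first by move: wi; rewrite ia wab wa.
  by split=> //; rewrite sc //; apply/eqP => ib; move: ic; lia.
have [ib|ib] := eqVneq i b; [by left|right; split=> //].
have ia : i != a by apply: contra_not_neq Ja => <-.
by rewrite -sc.
Qed.

(** A point farther than [b - a] from [c] cannot be moved across [c], so only finitely many points
    need inspection. *)
Lemma refl_le_near (n : nat) (a b c x : int) : a < b ->
  (c - (b - a) < x <= c + (b - a) -> (refl n a b x <= c) = (x <= c)) ->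
  (refl n a b x <= c) = (x <= c).
Proof.
move=> ab near_c; have xb := refl_bound n x ab.
have [xc|xc] := boolP (c - (b - a) < x <= c + (b - a)); first exact: near_c.
clear near_c; lia.
Qed.

Ltac near_cases :=
  rewrite /refl_n /refl_0 /refl_mid /refl !dvd_period_small; try lia;
  try (case: ifP => [/orP[]/or3P[]/eqP ?|?]; try lia;
       case: ifP => [/orP[]/or3P[]/eqP ?|?]; lia).

Lemma refl_mid_le0 (n i : nat) (x : int) : (0 < i < n)%N ->
  (refl_mid n i x <= 0) = (x <= 0).
Proof.
move=> ir; apply: refl_le_near; first by lia.
have pE := periodE n; move=> xr; have [->|->] : x = 0 \/ x = 1 by lia.
  by near_cases.
by near_cases.
Qed.

Lemma refl_mid_len (n i : nat) (x : int) : (0 < i < n)%N ->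
  (refl_mid n i x <= n%:Z) = (x <= n%:Z).
Proof.
move=> ir; apply: refl_le_near; first by lia.
have pE := periodE n; move=> xr; have [->|->] : x = n%:Z \/ x = n%:Z + 1 by lia.
  by near_cases.
by near_cases.
Qed.

Lemma refl_n_le0 (n : nat) (x : int) : (0 < n)%N -> (refl_n n x <= 0) = (x <= 0).
Proof.
move=> n0; apply: refl_le_near; first by lia.
have pE := periodE n; move=> xr; have [->|->] : x = 0 \/ x = 1 by lia.
  by near_cases.
by near_cases.
Qed.

Lemma refl_0_len (n : nat) (x : int) : (1 < n)%N ->
  (refl_0 n x <= n%:Z) = (x <= n%:Z).
Proof.
move=> n1; apply: refl_le_near; first by lia.
by have pE := periodE n; move=> xr; near_cases.
Qed.

Lemma refl_0_le0 (n : nat) (x : int) : (1 < n)%N -> x != - 1 -> x != 1 ->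
  (refl_0 n x <= 0) = (x <= 0).
Proof.
move=> n1 x1 x1'; apply: refl_le_near; first by lia.
by have pE := periodE n; move=> xr; near_cases.
Qed.

Lemma refl_n_len (n : nat) (x : int) : (0 < n)%N -> x != n%:Z -> x != n%:Z + 1 ->
  (refl_n n x <= n%:Z) = (x <= n%:Z).
Proof.
move=> n0 xn xn'; apply: refl_le_near; first by lia.
by have pE := periodE n; move=> xr; near_cases.
Qed.

Definition even0 (w : int -> int) : Prop := even_card (crossings 0 w).
Definition evenn (n : nat) (w : int -> int) : Prop := even_card (crossings n%:Z w).

Lemma even0_mid (n i : nat) (w : int -> int) : (0 < i < n)%N ->
  even0 (w \o refl_mid n i) <-> even0 w.
Proof.
move=> ir; apply: even_crossings_comp; first exact/reflK/refl_mid_nondegenerate.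
by move=> j; apply: refl_mid_le0.
Qed.

Lemma evenn_mid (n i : nat) (w : int -> int) : (0 < i < n)%N ->
  evenn n (w \o refl_mid n i) <-> evenn n w.
Proof.
move=> ir; apply: even_crossings_comp; first exact/reflK/refl_mid_nondegenerate.
by move=> j; apply: refl_mid_len.
Qed.

Lemma even0_refl_n (n : nat) (w : int -> int) : (0 < n)%N ->
  even0 (w \o refl_n n) <-> even0 w.
Proof.
move=> n0; apply: even_crossings_comp; first exact/reflK/refl_n_nondegenerate.
by move=> j; apply: refl_n_le0.
Qed.

Lemma evenn_refl_0 (n : nat) (w : int -> int) : (1 < n)%N ->
  evenn n (w \o refl_0 n) <-> evenn n w.
Proof.
move=> n1; apply: even_crossings_comp; first exact/reflK/refl_0_nondegenerate/ltnW.
by move=> j; apply: refl_0_len.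
Qed.

Lemma even0_refl_0 (n : nat) (w : int -> int) : (1 < n)%N -> mirrored n w ->
  even0 (w \o refl_0 n) <-> ~ even0 w.
Proof.
move=> n1 wM; have nd := refl_0_nondegenerate (ltnW n1).
apply: (@even_crossings_flip n _ _ _ (- 1) 1) => //.
- exact: mirrored_refl.
- exact: reflK.
- by move=> i i1 i1'; apply: refl_0_le0.
- have [_ _ ->] := wM.
  have : w 1 != 0.
    rewrite -(mirrored0 wM) (inj_eq (mirrored_inj wM)); lia.
  by rewrite add0r; move: (w 1) => z; lia.
Qed.

Lemma evenn_refl_n (n : nat) (w : int -> int) : (0 < n)%N -> mirrored n w ->
  evenn n (w \o refl_n n) <-> ~ evenn n w.
Proof.
move=> n0 wM; have nd := refl_n_nondegenerate n0.
apply: (@even_crossings_flip n _ _ _ n%:Z (n%:Z + 1)) => //.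
- exact: mirrored_refl.
- exact: reflK.
- exact: refl_l.
- lia.
- by move=> i i1 i1'; apply: refl_n_len.
- have -> : n%:Z + 1 = 1 * period n - n%:Z by rewrite periodE; lia.
  by rewrite mirroredB // periodE; lia.
Qed.

(** As a conjugate of [refl_mid n 1] by [refl_0], the type D generator flips the parity at 0 twice,
    hence keeps it. *)
Lemma refl_0D (n : nat) : (1 < n)%N ->
  refl n (- 1) 2 = refl_0 n \o refl_mid n 1 \o refl_0 n.
Proof.
move=> n1; have pE := periodE n.
have nd := refl_0_nondegenerate (ltnW n1); have rM := mirrored_refl nd.
rewrite /refl_mid (mirrored_refl_conj _ _ rM) refl_r //.
have -> : refl n (- 1) 1 (1 + 1) = 2 by near_cases.
by apply/funext => x /=; rewrite /refl_0 reflK.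
Qed.

Lemma refl_nD (n : nat) : (1 < n)%N ->
  refl n n%:Z (n%:Z + 2) = refl_n n \o refl_mid n n.-1 \o refl_n n.
Proof.
move=> n1; have pE := periodE n.
have nd := refl_n_nondegenerate (ltnW n1); have rM := mirrored_refl nd.
rewrite /refl_mid (mirrored_refl_conj _ _ rM).
have -> : n.-1%:Z + 1 = n%:Z by lia.
rewrite refl_l.
have -> : refl n n%:Z (n%:Z + 1) n.-1%:Z = n.-1%:Z by near_cases.
(* Conjugation yields the pair [(n - 1, n + 1)], which negation and a translation by the period turn
   into [(n, n + 2)]. *)
have -> : refl n n.-1%:Z (n%:Z + 1) = refl n n%:Z (n%:Z + 2).
  apply: refl_same; [lia|right].
  have -> : n.-1%:Z + (n%:Z + 2) = period n by lia.
  exact: dvdzz.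
by apply/funext => x /=; rewrite /refl_n reflK.
Qed.

Lemma mirrored_gen (X : qtype) (n i : nat) : (min_rank X <= n)%N -> (i <= n)%N ->
  mirrored n (gen X n i).
Proof.
by move=> hn ilen; rewrite genE //; apply/mirrored_refl/simple_pair_nondegenerate.
Qed.

Lemma genK (X : qtype) (n i : nat) : (min_rank X <= n)%N -> (i <= n)%N ->
  involutive (gen X n i).
Proof.
by move=> hn ilen; rewrite genE //; apply/reflK/simple_pair_nondegenerate.
Qed.

Lemma affine_groupE (X : qtype) (n : nat) (w : int -> int) :
  affine_group X n w <->
  [/\ mirrored n w, typeD_0 X -> even0 w & typeD_n X -> evenn n w].
Proof.
by rewrite /affine_group /even0 /evenn /crossings add0r.
Qed.

Lemma affine_group_gen (X : qtype) (n i : nat) (w : int -> int) :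
  (min_rank X <= n)%N -> (i <= n)%N ->
  affine_group X n w -> affine_group X n (w \o gen X n i).
Proof.
move=> hn ilen /affine_groupE[wM e0 en]; have gM := mirrored_gen hn ilen.
have [n1 _ _ _] := min_rank_typeD hn; have n0 := ltnW n1.
have r0M := mirrored_refl (refl_0_nondegenerate n0).
have rnM := mirrored_refl (refl_n_nondegenerate n0).
apply/affine_groupE; split; first exact: mirrored_comp.
- move=> D; have {}e0 := e0 D; rewrite genE // /simple_pair D.
  case: eqP => [_|/eqP i0] /=; last case: eqP => [_|/eqP jn] /=.
  + have r1M := mirrored_refl (@refl_mid_nondegenerate n 1 n1).
    rewrite refl_0D // compA even0_refl_0 //; last first.
      by rewrite compA; do 2!apply: mirrored_comp => //.
    by rewrite compA even0_mid // even0_refl_0 //; apply.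
  + case: (typeD_n X); last by rewrite even0_refl_n.
    have r1M := @refl_mid_nondegenerate n n.-1.
    by rewrite refl_nD // !compA even0_refl_n // even0_mid ?even0_refl_n //; lia.
  + by rewrite even0_mid //; lia.
- move=> D; have {}en := en D; rewrite genE // /simple_pair D.
  case: eqP => [_|/eqP i0] /=; last case: eqP => [_|/eqP jn] /=.
  + case: (typeD_0 X); last by rewrite evenn_refl_0.
    by rewrite refl_0D // !compA evenn_refl_0 // evenn_mid ?evenn_refl_0 //; lia.
  + have ir : (0 < n.-1 < n)%N by lia.
    have r1M := mirrored_refl (refl_mid_nondegenerate ir).
    rewrite refl_nD // compA evenn_refl_n //; last first.
      by rewrite compA; do 2!apply: mirrored_comp => //.
    by rewrite compA evenn_mid // evenn_refl_n //; apply.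
  + by rewrite evenn_mid //; lia.
Qed.

(** * Words and descents *)

Definition letters (n : nat) (e : seq nat) : bool := all (fun i => i <= n)%N e.

Lemma word_prod_rcons (X : qtype) (n : nat) (e : seq nat) (i : nat) :
  word_prod X n (rcons e i) = word_prod X n e \o gen X n i.
Proof. by elim: e => [|j e /= ->]. Qed.

Lemma mirrored_word (X : qtype) (n : nat) (e : seq nat) :
  (min_rank X <= n)%N -> letters n e -> mirrored n (word_prod X n e).
Proof.
move=> hn; elim: e => [_|j e IH /andP[jn en]] /=; first exact: mirrored_id.
by apply: mirrored_comp; [exact: mirrored_gen|exact: IH].
Qed.

Definition descent (X : qtype) (n : nat) (w : int -> int) (i : nat) : bool :=
  w (simple_pair X n i).2 < w (simple_pair X n i).1.

(* The first letter, from the right, at which the images of the i-th simple pair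
   get inverted is a reflection conjugate to the i-th generator; drop it. *)
Lemma exchange (X : qtype) (n i : nat) (e : seq nat) :
  (min_rank X <= n)%N -> (i <= n)%N -> letters n e ->
  descent X n (word_prod X n e) i ->
  exists e', [/\ letters n e', size e = (size e').+1
    & word_prod X n e' = word_prod X n e \o gen X n i].
Proof.
move=> hn ilen; rewrite /descent.
set p := (simple_pair X n i).1; set q := (simple_pair X n i).2.
have pq : p < q := simple_pair_lt X n i.
have gK := genK hn ilen.
elim: e => [_ /=|j e IH /= /andP[jn en]]; first by move/ltW; rewrite leNgt pq.
have wM := mirrored_word hn en; set w := word_prod X n e in IH wM *.
case: (ltgtP (w p) (w q)) => [lt_w|gt_w _|/(mirrored_inj wM) pqE]; last first.
- by rewrite pqE ltxx in pq.
- have [//|//|e' [e'n e'e e'w]] := IH.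
  by exists (j :: e'); rewrite /= e'e jn e'n e'w.
rewrite (genE hn jn) => inv.
have w_root := is_root_mirrored wM (simple_pair_root hn ilen).
have [wd wc] := simple_refl_inversion hn jn w_root lt_w inv.
exists e; split=> //.
have -> : refl n (simple_pair X n j).1 (simple_pair X n j).2 = refl n (w p) (w q).
  by rewrite (refl_same wd wc).
rewrite -/w -(mirrored_refl_conj p q wM) -compA -genE //.
by apply/funext => x /=; rewrite gK.
Qed.

Definition displacement (n : nat) (w : int -> int) : int :=
  \sum_(0 <= j < n) (w j.+1%:Z - j.+1%:Z) ^+ 2.

Lemma displacement_lt (n i j : nat) (v w : int -> int) :
  (0 < i <= n)%N -> (0 < j <= n)%N -> i != j ->
  (forall k : nat, (0 < k <= n)%N -> k != i -> k != j -> v k%:Z = w k%:Z) ->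
  (v i%:Z - i%:Z) ^+ 2 + (v j%:Z - j%:Z) ^+ 2 <
    (w i%:Z - i%:Z) ^+ 2 + (w j%:Z - j%:Z) ^+ 2 ->
  displacement n v < displacement n w.
Proof.
move=> /andP[i0 iN] /andP[j0 jN] ij vw lt_ij; rewrite /displacement !big_mkord.
have iN' : (i.-1 < n)%N by lia.
have jN' : (j.-1 < n)%N by lia.
have iP := prednK i0; have jP := prednK j0.
have jiP : Ordinal jN' != Ordinal iN' by rewrite -val_eqE /=; lia.
rewrite (bigD1 (Ordinal iN')) // [ltRHS](bigD1 (Ordinal iN')) //=.
rewrite (bigD1 (Ordinal jN')) // [X in _ < _ + X](bigD1 (Ordinal jN')) //=.
rewrite iP jP !addrA; set s := (X in _ + X < _); set t := (X in _ < _ + X).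
suff -> : s = t by rewrite ltrD2r.
apply: eq_bigr => k /andP[]; rewrite -!val_eqE /= => ki kj.
by have kn := ltn_ord k; rewrite vw; lia.
Qed.

Lemma displacement_ge0 (n : nat) (w : int -> int) : 0 <= displacement n w.
Proof. by apply: sumr_ge0 => j _; apply: sqr_ge0. Qed.

(** Exchanging the values at [p < q] when [w q < w p] lowers the sum of the two squares by
    [2(q - p)(w p - w q)]. Entries outside 1, ..., [n] are folded back by [w (- x) = - w x] and
    [w (N - x) = N - w x], which preserve the squares. *)
Lemma displacement_descent (X : qtype) (n i : nat) (w : int -> int) :
  (min_rank X <= n)%N -> (i <= n)%N -> mirrored n w -> descent X n w i ->
  displacement n (w \o gen X n i) < displacement n w.
Proof.
move=> hn ilen wM; have [n1 D0 Dn _] := min_rank_typeD hn.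
have nd := simple_pair_nondegenerate hn ilen; have wN : forall x, w (- x) = - w x by case: wM.
have wNB x : w (period n - x) = period n - w x.
  by rewrite -[period n]mul1r mirroredB.
have pE := periodE n.
rewrite genE // /descent; move: nd; rewrite /simple_pair.
case: eqP => [_|/eqP i0] /=; last case: eqP => [_|/eqP jn] /=.
- case: (typeD_0 X) D0 => [/(_ isT) n2|_] nd.
    have E1 : refl n (- 1) 2 1 = - 2 by near_cases.
    have E2 : refl n (- 1) 2 2 = - 1 by near_cases.
    rewrite wN => lt; apply: (@displacement_lt n 1 2) => /=; [lia..| |].
      by move=> k kr k1 k2; congr (w _); near_cases.
    rewrite E1 E2 !wN !expr2; move: lt; move: (w 1) (w 2) => a b; lia.
  have E1 : refl n (- 1) 1 1 = - 1 by near_cases.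
  have E2 : refl n (- 1) 1 2 = 2 by near_cases.
  (* Position 2 is fixed here; it only provides the second index for [displacement_lt]. *)
  rewrite wN => lt; apply: (@displacement_lt n 1 2) => /=; [lia..| |].
    by move=> k kr k1 k2; congr (w _); near_cases.
  rewrite E1 E2 !wN !expr2; move: lt; move: (w 1) (w 2) => a b; lia.
- have nE : n.-1%:Z = n%:Z - 1 by lia.
  have w1 : w (n%:Z + 1) = period n - w n%:Z.
    by rewrite -wNB; congr (w _); lia.
  have w2 : w (n%:Z + 2) = period n - w (n%:Z - 1).
    by rewrite -wNB; congr (w _); lia.
  case: (typeD_n X) Dn => [/(_ isT) n2|_] nd.
    have E1 : refl n n%:Z (n%:Z + 2) n%:Z = n%:Z + 2 by near_cases.
    have E2 : refl n n%:Z (n%:Z + 2) (n%:Z - 1) = n%:Z + 1 by near_cases.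
    move=> lt; apply: (@displacement_lt n n n.-1) => /=; [lia..| |].
      by move=> k kr k1 k2; congr (w _); near_cases.
    rewrite nE E1 E2 w1; move: lt; rewrite w2 pE !expr2.
    move: (w n%:Z) (w (n%:Z - 1)) => a b; lia.
  have E1 : refl n n%:Z (n%:Z + 1) n%:Z = n%:Z + 1 by near_cases.
  have E2 : refl n n%:Z (n%:Z + 1) (n%:Z - 1) = n%:Z - 1 by near_cases.
  move=> lt; apply: (@displacement_lt n n n.-1) => /=; [lia..| |].
    by move=> k kr k1 k2; congr (w _); near_cases.
  rewrite nE E1 E2 w1; move: lt; rewrite w1 pE !expr2.
  move: (w n%:Z) (w (n%:Z - 1)) => a b; lia.
- move=> nd lt.
  have iE : i.+1%:Z = i%:Z + 1 by lia.
  apply: (@displacement_lt n i i.+1) => /=; [lia..| |].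
    by move=> k kr k1 k2; congr (w _); near_cases.
  rewrite iE refl_l refl_r // !expr2.
  move: lt; move: (w i%:Z) (w (i%:Z + 1)) => a b; lia.
Qed.

Lemma displacement_ind (n : nat) (P : (int -> int) -> Prop) :
  (forall w, (forall v, displacement n v < displacement n w -> P v) -> P w) ->
  forall w, P w.
Proof.
move=> H w; have [k] := ubnP `|displacement n w|%N.
elim: k w => // k IH w wk; apply: H => v vw; apply: IH.
have := displacement_ge0 n v; have := displacement_ge0 n w; lia.
Qed.

(** * Dominant elements *)

(** Unlike [dominant], this compares the entries [n] and [n + 1] in every type, so that the whole
    window is increasing and can be recovered from its set of values. *)
Definition ascending (n : nat) (w : int -> int) : Prop :=
  forall i : nat, (0 < i <= n)%N -> w i%:Z < w (i%:Z + 1).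

Definition dominant (X : qtype) (n : nat) (w : int -> int) : Prop :=
  forall i : nat, (0 < i <= n)%N -> w (simple_pair X n i).1 < w (simple_pair X n i).2.

Lemma ascending_window (n : nat) (w : int -> int) (j : nat) :
  mirrored n w -> ascending n w -> (0 < j < n.*2)%N -> w j%:Z < w j.+1%:Z.
Proof.
move=> wM wA jr; have [jn|jn] := leqP j n.
  by have := wA j; rewrite intS addrC; apply; lia.
have wNB x : w (period n - x) = period n - w x.
  by rewrite -[period n]mul1r mirroredB.
have pE := periodE n.
have -> : j%:Z = period n - ((n.*2 - j)%N%:Z + 1) by lia.
have -> : j.+1%:Z = period n - (n.*2 - j)%N%:Z by lia.
rewrite !wNB ltrD2l ltrN2; apply: wA; lia.
Qed.

Lemma ascending_lt (n : nat) (w : int -> int) (j k : nat) :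
  mirrored n w -> ascending n w -> (0 < j)%N -> (j < k)%N -> (k <= n.*2)%N ->
  w j%:Z < w k%:Z.
Proof.
move=> wM wA j0; elim: k => // k IH; rewrite ltnS leq_eqVlt => /predU1P[<- jn|jk kn].
  by apply: ascending_window wM wA _; rewrite j0.
apply: lt_trans (IH jk (ltnW kn)) _; by apply: ascending_window wM wA _; lia.
Qed.

Lemma ascending_sorted (n : nat) (w : int -> int) :
  mirrored n w -> ascending n w ->
  sorted <%R [seq w j%:Z | j <- iota 1 n.*2].
Proof.
move=> wM wA; apply: (@homo_sorted_in _ _ [pred j | 0 < j <= n.*2]%N (fun j : nat => w j%:Z) ltn).
- by move=> j k /andP[j0 jn] /andP[k0 kn] jk; apply: ascending_lt wM wA _ _ _.
- by apply/allP => j; rewrite mem_iota /= => /andP[j0 jn]; lia.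
- exact: iota_ltn_sorted.
Qed.

Lemma ascending_uniq (n : nat) (v w : int -> int) :
  mirrored n v -> mirrored n w -> ascending n v -> ascending n w ->
  (forall b, in_window n v b <-> in_window n w b) -> v = w.
Proof.
move=> vM wM vA wA vw.
have window_mem u b : (b \in [seq u j%:Z | j <- iota 1 n.*2]) <-> in_window n u b.
  split=> [/mapP[j]|[j jr ->]]; first by rewrite mem_iota => jr ->; exists j => //; lia.
  by apply/mapP; exists j => //; rewrite mem_iota; lia.
have mapE : [seq v j%:Z | j <- iota 1 n.*2] = [seq w j%:Z | j <- iota 1 n.*2].
  apply: (irr_sorted_eq lt_trans ltxx); try exact: ascending_sorted.
  by move=> b; apply/idP/idP => /window_mem/vw/window_mem.
rewrite (mirror_extE (f := w) vM) -?(mirror_extE wM) // => -[j|j] jr; last by lia.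
have := congr1 (nth 0 ^~ j.-1) mapE.
by rewrite !(nth_map 0%N) ?size_iota ?nth_iota; try lia; rewrite add1n prednK; lia.
Qed.

(** Growth from a positive [w 1] gives [j <= w j] on the whole window; at the mirror position
    [N - j] this same bound reads [w j <= j]. *)
Lemma ascending_id (n : nat) (w : int -> int) :
  mirrored n w -> ascending n w -> 0 < w 1 -> w = id.
Proof.
move=> wM wA w1; have lb (j : nat) : (0 < j)%N -> (j <= n.*2)%N -> j%:Z <= w j%:Z.
  elim: j => // -[_ _ _|j IH _ jn]; first by rewrite -gtz0_ge1.
  have := IH isT (ltnW jn); have := ascending_window wM wA (j := j.+1) jn.
  by move: (w _) (w _) => a b; lia.
have pE := periodE n.
rewrite (mirror_extE (f := id) wM) -?(mirror_extE (mirrored_id n)) // => -[j|j] jr;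
  last by lia.
apply/eqP; rewrite eq_le lb ?andbT; try lia.
have := lb (n.*2.+1 - j)%N; have -> : (n.*2.+1 - j)%N%:Z = 1 * period n - j%:Z by lia.
rewrite mirroredB //; lia.
Qed.

(** In type D the entries [n] and [n + 1] may be in the wrong order. Exchanging them then requires
    [w (n - 1) < w (n + 1)], the mirror form of the dominance condition [w n < w (n + 2)]. *)
Lemma dominant_ascending (X : qtype) (n : nat) (w : int -> int) :
  (min_rank X <= n)%N -> mirrored n w -> dominant X n w ->
  ascending n w \/ typeD_n X /\ ascending n (w \o refl_n n).
Proof.
move=> hn wM wD; have [n1 _ _ _] := min_rank_typeD hn; have n0 := ltnW n1.
have wmid (i : nat) : (0 < i < n)%N -> w i%:Z < w (i%:Z + 1).
  move=> ir; have := wD i; rewrite /simple_pair /=.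
  have [-> ->] : (i == 0)%N = false /\ (i == n) = false by split; lia.
  by apply; lia.
have := wD n; rewrite n0 leqnn /simple_pair (gtn_eqF n0) eqxx /= => /(_ isT).
case: (typeD_n X) => wn; last first.
  left=> i ir; have [->//|i_n] := eqVneq i n; apply: wmid; lia.
have pE := periodE n.
have wNB x : w (period n - x) = period n - w x.
  by rewrite -[period n]mul1r mirroredB.
have w1 : w (n%:Z + 1) = period n - w n%:Z by rewrite -wNB; congr (w _); lia.
have w2 : w (n%:Z + 2) = period n - w (n%:Z - 1) by rewrite -wNB; congr (w _); lia.
have [lt_n|ge_n] := ltP (w n%:Z) (w (n%:Z + 1)).
  left=> i ir; have [->//|i_n] := eqVneq i n; apply: wmid; lia.
have nd := refl_n_nondegenerate n0.
have neq : w n%:Z != w (n%:Z + 1) by rewrite (inj_eq (mirrored_inj wM)); lia.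
right; split=> // i ir /=; have [->|i_n] := eqVneq i n.
  by rewrite /refl_n refl_l refl_r //; lia.
have [iE|i_n1] := eqVneq i n.-1.
  have -> : i%:Z + 1 = n%:Z by lia.
  rewrite /refl_n refl_l.
  have -> : refl n n%:Z (n%:Z + 1) i%:Z = n%:Z - 1 by near_cases.
  by move: wn; rewrite w1 w2; lia.
have -> : refl_n n i%:Z = i%:Z by near_cases.
have -> : refl_n n (i%:Z + 1) = i%:Z + 1 by near_cases.
by apply: wmid; lia.
Qed.

Lemma ascending_dominant (X : qtype) (n : nat) (w : int -> int) :
  (min_rank X <= n)%N -> mirrored n w -> ascending n w -> dominant X n w.
Proof.
move=> hn wM wA i ir; have [n1 _ _ _] := min_rank_typeD hn.
rewrite /simple_pair; case: eqP => [i0|_] /=; first by lia.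
case: eqP => [_|i_n] /=; last exact: wA.
case: (typeD_n X); last by apply: wA; lia.
have -> : n%:Z + 2 = n.+2%:Z by lia.
by apply: ascending_lt wM wA _ _ _; lia.
Qed.

(** The type D conditions never compare the entries [n] and [n + 1], so exchanging them is harmless.
    This allows the parity at [n] to be repaired. *)
Lemma ascending_dominant_refl_n (X : qtype) (n : nat) (w : int -> int) :
  (min_rank X <= n)%N -> typeD_n X -> mirrored n w -> ascending n w ->
  dominant X n (w \o refl_n n).
Proof.
move=> hn D wM wA i ir; have [n1 _ /(_ D) n2 _] := min_rank_typeD hn.
have nd := refl_n_nondegenerate (ltnW n1); have pE := periodE n.
rewrite /simple_pair; case: eqP => [i0|_] /=; first by lia.
case: eqP => [i_n|i_n] /=; last first.
  have [iE|i_n1] := eqVneq i n.-1.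
    have -> : i%:Z + 1 = n%:Z by lia.
    rewrite /refl_n refl_l.
    have -> : refl n n%:Z (n%:Z + 1) i%:Z = n.-1%:Z by near_cases.
    have -> : n%:Z + 1 = n.+1%:Z by lia.
    by apply: ascending_lt wM wA _ _ _; lia.
  have -> : refl_n n i%:Z = i%:Z by near_cases.
  have -> : refl_n n (i%:Z + 1) = i%:Z + 1 by near_cases.
  by apply: wA; lia.
rewrite D {1}/refl_n refl_l.
have -> : refl_n n (n%:Z + 2) = n%:Z + 2 by near_cases.
have -> : n%:Z + 2 = n.+2%:Z by lia.
have -> : n%:Z + 1 = n.+1%:Z by lia.
by apply: ascending_lt wM wA _ _ _; lia.
Qed.

Lemma in_window_comp (n : nat) (w s : int -> int) (b : int) : involutive s ->
  (forall j : int, 0 < j < period n -> 0 < s j < period n) ->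
  in_window n (w \o s) b <-> in_window n w b.
Proof.
move=> sK sW.
have sub u c : in_window n (u \o s) c -> in_window n u c.
  move=> [j jr ->]; have := sW j%:Z; rewrite /= /period.
  by case: (s j%:Z) => k kr; [exists k => //|]; lia.
have wE : (w \o s) \o s = w by apply/funext => x /=; rewrite sK.
by split=> [|wb]; [exact: sub|apply: sub; rewrite wE].
Qed.

Lemma in_window_refl_n (n : nat) (w : int -> int) (b : int) : (0 < n)%N ->
  in_window n (w \o refl_n n) b <-> in_window n w b.
Proof.
move=> n0; apply: in_window_comp; first exact/reflK/refl_n_nondegenerate.
by move=> j jr; have pE := periodE n; near_cases.
Qed.

Lemma in_window_gen (X : qtype) (n i : nat) (w : int -> int) (b : int) :
  (min_rank X <= n)%N -> (0 < i <= n)%N ->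
  in_window n (w \o gen X n i) b <-> in_window n w b.
Proof.
move=> hn /andP[i0 ilen]; apply: in_window_comp; first exact: genK.
move=> j jr; have pE := periodE n; have [n1 _ Dn _] := min_rank_typeD hn.
rewrite genE // /simple_pair; case: eqP => [|_] /=; first by lia.
case: eqP => [_|/eqP i_n] /=; last by near_cases.
by case: (typeD_n X) Dn => [/(_ isT) n2|_]; near_cases.
Qed.

Lemma dominant_uniq (X : qtype) (n : nat) (v w : int -> int) :
  (min_rank X <= n)%N -> affine_group X n v -> affine_group X n w ->
  dominant X n v -> dominant X n w ->
  (forall b, in_window n v b <-> in_window n w b) -> v = w.
Proof.
move=> hn; have [n1 _ _ _] := min_rank_typeD hn; have n0 := ltnW n1.
have rM := mirrored_refl (refl_n_nondegenerate n0).
(* In type D at [n], parity admits only one of [u] and [u \o refl_n n], which rules out the two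
   mixed cases below. *)
have parity u : affine_group X n u -> typeD_n X ->
    affine_group X n (u \o refl_n n) -> False.
  move=> /affine_groupE[uM _ u_even] D /affine_groupE[_ _ /(_ D)].
  by rewrite evenn_refl_n // => /(_ (u_even D)).
move=> vG wG; have [vM _ _] := vG; have [wM _ _] := wG.
have uniq_c u u' := @ascending_uniq n u u'.
move=> /(dominant_ascending hn vM) vD /(dominant_ascending hn wM) wD vw.
have vrM := mirrored_comp vM rM; have wrM := mirrored_comp wM rM.
case: vD wD => [vA|[D vA]] [wA|[D' wA]].
- exact: uniq_c.
- have vE : v = w \o refl_n n.
    by apply: uniq_c => // b; rewrite vw in_window_refl_n.
  by case: (parity w) => //; rewrite -vE.
- have wE : v \o refl_n n = w.
    by apply: uniq_c => // b; rewrite in_window_refl_n.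
  by case: (parity v) => //; rewrite wE.
- have vwE : v \o refl_n n = w \o refl_n n.
    by apply: uniq_c => // b; rewrite !in_window_refl_n.
  have rK := reflK (refl_n_nondegenerate n0).
  apply/funext => x; have := congr1 (fun f => f (refl_n n x)) vwE.
  by rewrite /= /refl_n rK.
Qed.

Lemma not_descent (X : qtype) (n i : nat) (w : int -> int) :
  mirrored n w -> ~~ descent X n w i ->
  w (simple_pair X n i).1 < w (simple_pair X n i).2.
Proof.
move=> wM; rewrite -leNgt => le_w; rewrite lt_neqAle le_w andbT.
by rewrite (inj_eq (mirrored_inj wM)) lt_eqF ?simple_pair_lt.
Qed.

Lemma dominantPn (X : qtype) (n : nat) (w : int -> int) : mirrored n w ->
  ~ dominant X n w -> exists2 i, (0 < i <= n)%N & descent X n w i.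
Proof.
move=> wM; apply: contra_notP => nodesc i ir.
by apply: not_descent => //; apply/negP => wi; apply: nodesc; exists i.
Qed.

(** * Generation of the groups *)

Lemma even0_id : even0 id.
Proof.
exists 0%N => //; suff -> : crossings 0 id = set0 by rewrite II0.
by apply/seteqP; split=> // i [/=]; lia.
Qed.

Lemma evenn_id (n : nat) : evenn n id.
Proof.
exists 0%N => //; suff -> : crossings n%:Z id = set0 by rewrite II0.
by apply/seteqP; split=> // i [/=]; lia.
Qed.

(** Composing with [refl_0] replaces the first entry by [- w 1], which is positive and still below
    [w 2], so [ascending_id] applies. *)
Lemma ascending_refl_0_id (n : nat) (w : int -> int) :
  (2 < n)%N -> mirrored n w -> ascending n w -> w 1 < 0 -> - w 1 < w 2 ->
  w \o refl_0 n = id.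
Proof.
move=> n2 wM wA w1 w12; have n0 : (0 < n)%N by lia.
have nd := refl_0_nondegenerate n0; have pE := periodE n.
have wN : forall x, w (- x) = - w x by case: wM.
have rM := mirrored_refl nd.
have E1 : refl_0 n 1 = - 1 by exact: refl_r.
have fix_refl (j : int) : 2 <= j <= n%:Z + 1 -> refl_0 n j = j.
  by move=> jr; near_cases.
apply: (@ascending_id n); first exact: mirrored_comp.
  move=> i ir /=; have [->|i1] := eqVneq i 1%N.
    by rewrite E1 wN fix_refl //; lia.
  by rewrite !fix_refl; try lia; apply: wA.
by rewrite /= E1 wN oppr_gt0.
Qed.

(** Without descents, [w] is the identity up to [refl_0] and [refl_n]. Each of these can occur only
    when its end is of type D, and there the parity condition excludes it. *)
Lemma no_descent_id (X : qtype) (n : nat) (w : int -> int) :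
  (min_rank X <= n)%N -> affine_group X n w ->
  (forall i, (i <= n)%N -> ~~ descent X n w i) -> w = id.
Proof.
move=> hn /affine_groupE[wM e0 en] nodesc.
have [n1 D0n Dnn _] := min_rank_typeD hn; have n0 := ltnW n1.
have wN : forall x, w (- x) = - w x by case: wM.
have wD : dominant X n w by move=> i /andP[_ ilen]; exact/not_descent/nodesc.
have := not_descent wM (nodesc 0%N isT); rewrite /simple_pair /= wN => w01.
have rM : mirrored n (refl_n n) := mirrored_refl (refl_n_nondegenerate n0).
have pE := periodE n.
(* To be used for [w] and for [w \o refl_n n], which agree at 1 and 2 because [n > 2] in type D. *)
have bottom u : mirrored n u -> ascending n u -> u 1 = w 1 -> u 2 = w 2 ->
    u = id \/ typeD_0 X /\ u \o refl_0 n = id.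
  move=> uM uA u1 u2; have [u_pos|u_npos] := ltP 0 (u 1).
    by left; apply: ascending_id uM uA u_pos.
  have u_neq0 : u 1 != 0.
    by rewrite -(mirrored0 uM) (inj_eq (mirrored_inj uM)).
  have u_neg : u 1 < 0 by rewrite lt_neqAle u_neq0.
  case: (typeD_0 X) D0n w01 => [/(_ isT) n2|_] w01; last first.
    by move: w01 u_neg; rewrite u1; move: (w 1) => a; lia.
  by right; split=> //; apply: ascending_refl_0_id => //; rewrite u1 u2.
case: (dominant_ascending hn wM wD) => [wA|[D wA]].
  have [//|[D w_id]] := bottom w wM wA erefl erefl.
  by have := (even0_refl_0 n1 wM).1; rewrite w_id => /(_ even0_id (e0 D)).
have n2 := Dnn D.
have fix_refl (j : int) : 1 <= j < n%:Z -> refl_n n j = j.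
  by move=> jr; near_cases.
exfalso; apply: ((evenn_refl_n n0 wM).1 _ (en D)).
have [] := bottom _ (mirrored_comp wM rM) wA; rewrite /= ?fix_refl //; try lia.
  by move=> ->; apply: evenn_id.
move=> [_ w_id]; apply/(@evenn_refl_0 n _ n1); rewrite w_id; exact: evenn_id.
Qed.

Lemma affine_group_generated (X : qtype) (n : nat) (w : int -> int) :
  (min_rank X <= n)%N -> affine_group X n w ->
  exists2 e, letters n e & word_prod X n e = w.
Proof.
move=> hn; elim/(@displacement_ind n): w => w IH wG; have [wM _ _] := wG.
have [[i ilen wi]|nodesc] := pselect (exists2 i, (i <= n)%N & descent X n w i).
  have [e en ew] := IH _ (displacement_descent hn ilen wM wi) (affine_group_gen hn ilen wG).
  exists (rcons e i); first by rewrite /letters all_rcons ilen.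
  by rewrite word_prod_rcons ew; apply/funext => x /=; rewrite genK.
exists [::] => //; symmetry; apply: no_descent_id hn wG _ => i ilen.
by apply/negP => wi; apply: nodesc; exists i.
Qed.

(** * Lengths and minimal coset representatives *)

Lemma has_length_exists (X : qtype) (n : nat) (e : seq nat) : letters n e ->
  exists2 l, has_length X n (word_prod X n e) l & (l <= size e)%N.
Proof.
move=> en; set w := word_prod X n e.
pose P l := `[< exists e', [/\ letters n e', word_prod X n e' = w & size e' = l] >].
have P_ex : exists l, P l by exists (size e); apply/asboolP; exists e.
have [l /asboolP Pl l_min] := ex_minnP P_ex.
exists l; last by apply: l_min; apply/asboolP; exists e.
by split=> // e' e'n e'w; apply: l_min; apply/asboolP; exists e'.
Qed.

Lemma parabolic_gen (X : qtype) (n i : nat) (u : int -> int) : (0 < i <= n)%N ->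
  parabolic X n u -> parabolic X n (u \o gen X n i).
Proof.
move=> ir [e en eu]; exists (rcons e i); first by rewrite all_rcons ir.
by rewrite word_prod_rcons eu.
Qed.

Lemma parabolic_coset (X : qtype) (n : nat) (w u : int -> int) :
  (min_rank X <= n)%N -> parabolic X n u -> affine_group X n w ->
  affine_group X n (w \o u) /\ forall b, in_window n (w \o u) b <-> in_window n w b.
Proof.
move=> hn [e en <-] wG; elim/last_ind: e en => [_|e i IH]; first by [].
rewrite all_rcons => /andP[ir en]; have [eG eW] := IH en.
rewrite word_prod_rcons compA; split=> [|b]; last by rewrite in_window_gen // eW.
by apply: affine_group_gen => //; case/andP: ir.
Qed.

(** While [w \o u] has a descent at some [i] in 1, ..., [n], [exchange] removes a letter and stays
    in the coset. When no such descent remains, the element is dominant with the window of [w],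
    hence equals [w]. *)
Lemma dominant_word_le (X : qtype) (n : nat) (w u : int -> int) (e : seq nat) :
  (min_rank X <= n)%N -> affine_group X n w -> dominant X n w ->
  parabolic X n u -> letters n e -> word_prod X n e = w \o u ->
  exists e', [/\ letters n e', word_prod X n e' = w & (size e' <= size e)%N].
Proof.
move=> hn wG wD; have [k] := ubnP (size e).
elim: k u e => // k IH u e ek uP en eu.
have [uG uW] := parabolic_coset hn uP wG; have [uM _ _] := uG.
have [uD|] := pselect (dominant X n (w \o u)).
  by exists e; rewrite eu (dominant_uniq hn uG wG uD wD uW).
move/(dominantPn uM) => [i ir ui]; have /andP[_ ilen] := ir.
have [|e1 [e1n e1e e1u]] := exchange hn ilen en (i := i); first by rewrite eu.
have [||e' [e'n e'w e'e]] := IH _ e1 _ (parabolic_gen ir uP) e1n.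
- by rewrite -e1e.
- by rewrite e1u eu compA.
- by exists e'; split=> //; rewrite e1e; apply: leqW.
Qed.

(** Replaces minimality of length by inequalities. A descent at [i] would make [w \o gen X n i] a
    shorter element of the coset; the converse is [dominant_word_le]. *)
Lemma min_coset_repsP (X : qtype) (n : nat) (w : int -> int) :
  (min_rank X <= n)%N ->
  min_coset_reps X n w <-> affine_group X n w /\ dominant X n w.
Proof.
move=> hn; split=> [[wG [l [[e [en ew el]] _] l_min]]|[wG wD]].
  split=> //; have [wM _ _] := wG; apply: contrapT => /(dominantPn wM)[i ir wi].
  have /andP[_ ilen] := ir.
  have [|e' [e'n e'e e'w]] := exchange hn ilen en (i := i); first by rewrite ew.
  have [l' l'_len l'_le] := has_length_exists X e'n.
  have := l_min (gen X n i) l'; rewrite -ew -e'w leqNgt -el e'e ltnS l'_le /=.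
  suff iP : parabolic X n (gen X n i) by move/(_ iP l'_len).
  by exists [:: i]; rewrite //= ir.
split=> //; have [e en ew] := affine_group_generated hn wG.
have [l] := has_length_exists X en; rewrite ew => l_len _; exists l => //.
move=> u l' uP [[e1 [e1n e1u <-]] _].
have [e' [e'n e'w e'_le]] := dominant_word_le hn wG wD uP e1n e1u.
by apply: leq_trans e'_le; apply: l_len.2.
Qed.

(** * Abaci *)

Lemma lowest_bead_uniq (n : nat) (A : set int) (i : nat) (b c : int) :
  lowest_bead n A i b -> lowest_bead n A i c -> b = c.
Proof.
by move=> [Ab bi bmax] [Ac ci cmax]; apply/eqP; rewrite eq_le cmax ?bmax.
Qed.

Lemma lowest_bead_abacus (n : nat) (w : int -> int) (i : nat) (b : int) :
  mirrored n w -> (1 <= i <= n.*2)%N -> in_window n w b -> runner n i b ->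
  lowest_bead n (abacus_of n w) i b.
Proof.
move=> wM ir bw bi; have [_ _ Al] := abacus_ofP wM.
have [c c_low cw] := Al i ir; have [_ ci _] := c_low.
by rewrite (window_inj wM bw cw bi ci).
Qed.

Lemma in_window_entry (n : nat) (w : int -> int) (b : int) :
  mirrored n w -> in_window n w b -> entries n b.
Proof.
move=> wM [j jr ->]; rewrite /entries /= dvd_mirrored //.
by have pE := periodE n; rewrite dvd_period_small; lia.
Qed.

Lemma in_window_abacus (n : nat) (w : int -> int) (b : int) : mirrored n w ->
  in_window n w b <->
  exists2 i, (1 <= i <= n.*2)%N & lowest_bead n (abacus_of n w) i b.
Proof.
move=> wM; split=> [bw|[i ir b_low]].
  have [i ir bi] := (entry_runner n b).1 (in_window_entry wM bw).
  by exists i => //; apply: lowest_bead_abacus.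
have [_ _ Al] := abacus_ofP wM; have [c c_low cw] := Al i ir.
by rewrite (lowest_bead_uniq b_low c_low).
Qed.

(** Writing [y] as [k * period n + j] with [j] in the window, [w y] sits [k] levels from [w j], the
    lowest bead of its runner; by flushness it is a bead exactly when [k <= 0]. *)
Lemma abacus_of_mirrored (n : nat) (w : int -> int) (y : int) :
  mirrored n w -> ~~ (period n %| y)%Z -> abacus_of n w (w y) <-> y < period n.
Proof.
move=> wM /(entry_runner n y)[j jr [k ->]]; have [_ Af _] := abacus_ofP wM.
have jw : in_window n w (w j%:Z) by exists j.
have [i ir ji] := (entry_runner n _).1 (in_window_entry wM jw).
have [Aj _ j_max] := lowest_bead_abacus wM ir jw ji.
rewrite mirrored_shift //.
have yi : runner n i (k * period n + w j%:Z).
  by case: ji => m ->; exists (k + m); rewrite mulrDl addrA.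
have pE := periodE n; split=> [/j_max/(_ yi)|lt_y].
  by rewrite gerDr => k0; nia.
have k0 : k <= 0 by rewrite leNgt; apply/negP => k_pos; nia.
apply: contrapT => Ay; have [k_eq|k_neq] := eqVneq k 0.
  by apply: Ay; rewrite k_eq mul0r add0r.
apply: (Af i (w j%:Z) (k * period n + w j%:Z)) => //.
  by split=> //; apply/entry_runner; exists i.
by nia.
Qed.

(* The gaps before N are the w y with y > N, and y |-> N - y sends them to the
   crossings of 0. *)
Lemma even_abacus_crossings (n : nat) (w : int -> int) : mirrored n w ->
  even_abacus n (abacus_of n w) <-> even0 w.
Proof.
move=> wM; have wNB x : w (period n - x) = period n - w x.
  by rewrite -[period n]mul1r mirroredB.
have fI : injective (fun i => period n - w i).
  by move=> i j /addrI/oppr_inj/(mirrored_inj wM).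
rewrite /even0 -(even_card_image _ fI) /even_abacus.
suff -> : [set g | gaps n (abacus_of n w) g /\ g < period n] =
    (fun i => period n - w i) @` crossings 0 w by [].
apply/seteqP; split=> [g [[g_entry g_gap] gN]|_ [i [i0 wi] <-]].
  have [[v vK wK] _ _] := wM; exists (period n - v g); last by rewrite wNB wK; lia.
  have vg : ~~ (period n %| v g)%Z by rewrite -(dvd_mirrored _ wM) wK.
  have vgN : ~ (v g < period n).
    by move/(abacus_of_mirrored wM vg); rewrite wK.
  by rewrite /crossings /= wNB wK; split; lia.
(* A multiple of the period is fixed by [w], so it is not a crossing of 0. *)
have i_entry : ~~ (period n %| period n - i)%Z.
  rewrite rpredBl ?dvdzz //; apply/negP => /dvdzP[k iE].
  have w0 := mirrored0 wM.
  by move: wi; rewrite iE -[k * _]addr0 mirrored_shift // w0 addr0 -iE; lia.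
rewrite -wNB; split; last by rewrite wNB; lia.
split; first by rewrite /entries /= dvd_mirrored.
by move/(abacus_of_mirrored wM i_entry); lia.
Qed.

(** The rule [w (N - j) = N - w j] pairs the lowest beads of opposite runners. *)
Lemma balanced_abacus_of (n : nat) (w : int -> int) :
  mirrored n w -> balanced n (abacus_of n w).
Proof.
move=> wM; have [_ _ Al] := abacus_ofP wM.
split=> i ir; have [b b_low bw] := Al i ir; first by case: b_low; exists b.
exists b, (period n - b).
split=> //; last by rewrite addrC subrK.
have pE := periodE n.
apply: lowest_bead_abacus => //; first by lia.
  case: bw => j jr ->; exists (n.*2.+1 - j)%N; first by lia.
  have -> : (n.*2.+1 - j)%N%:Z = 1 * period n - j%:Z by lia.
  by rewrite mirroredB // mul1r.
by case: b_low => _ [m ->] _; exists (- m); lia.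
Qed.

Lemma abacus_of_abaci (X : qtype) (n : nat) (w : int -> int) :
  affine_group X n w -> abaci X n (abacus_of n w).
Proof.
move=> /affine_groupE[wM e0 _]; have [Ae Af _] := abacus_ofP wM.
split=> //; first exact: balanced_abacus_of.
by case: X e0 => //= /(_ isT)/(even_abacus_crossings wM).
Qed.

(** Let [w] shift each residue class by the level of the lowest bead on its runner. Balance says
    that opposite runners have opposite levels, which makes [w] odd. *)
Lemma mirrored_of_balanced (n : nat) (A : set int) :
  is_abacus n A -> flush n A -> balanced n A ->
  exists2 w, mirrored n w & abacus_spec n w A.
Proof.
move=> Ae Af [_ Ab].
have K_ex (i : nat) : exists k : int, (1 <= i <= n.*2)%N ->
    lowest_bead n A i (k * period n + i%:Z).
  have [ir|] := boolP (1 <= i <= n.*2)%N; last by exists 0.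
  have [b [_ [[Ab_ [k bE] b_max] _ _]]] := Ab i ir.
  by exists k => _; rewrite -bE; split=> //; exists k.
have [K0 K0_low] := choice K_ex.
(* Residue 0 has no runner; level 0 there makes [w] fix the multiples of the period. *)
pose K (r : int) : int := if r == 0 then 0 else K0 `|r|%N.
have pE := periodE n.
have KN (r : int) : 0 < r < period n -> K (period n - r) = - K r.
  case: r => r rr; last by lia.
  rewrite /K; have [-> ->] : (r%:Z == 0) = false /\ (period n - r%:Z == 0) = false.
    by split; lia.
  have ir : (1 <= r <= n.*2)%N by lia.
  have -> : (`|period n - r%:Z| = n.*2.+1 - r)%N by lia.
  have [b [b' [b_low b'_low bb']]] := Ab r ir.
  have ir' : (1 <= n.*2.+1 - r <= n.*2)%N by lia.
  move: bb'; rewrite (lowest_bead_uniq b_low (K0_low _ ir)).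
  rewrite (lowest_bead_uniq b'_low (K0_low _ ir')) => E.
  have rE : (n.*2.+1 - r)%N%:Z = period n - r%:Z by lia.
  move: E; rewrite rE; move: (K0 _) (K0 _) => k k' E.
  have {}E : (k + k') * period n = 0 by lia.
  by move/eqP: E; rewrite mulf_eq0 => /orP[/eqP|]; lia.
pose w x := K (x %% period n)%Z * period n + x.
have wM : mirrored n w.
  split.
  (* Shifting by levels preserves residues, so the opposite shift is the inverse. *)
  - exists (fun x => x - K (x %% period n)%Z * period n) => x; rewrite /w /=.
      by rewrite modzMDl addrAC subrr add0r.
      by rewrite -mulNr [x + _]addrC modzMDl mulNr addrA addrN add0r.
  - by move=> x; rewrite /w modzDr addrA.
  - move=> x; rewrite /w; have := divz_eq x (period n).
    have : 0 <= (x %% period n)%Z < period n.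
      by rewrite modz_ge0 ?ltz_pmod // gt_eqF.
    move: (x %% _)%Z (x %/ _)%Z => r q r_bd xE.
    have [r0|r0] := eqVneq r 0.
      rewrite xE r0 addr0 -mulNr modzMl /K eqxx; lia.
    have -> : (- x %% period n)%Z = period n - r.
      have -> : - x = (- q - 1) * period n + (period n - r) by lia.
      by rewrite modzMDl modz_small //; lia.
    by rewrite KN; lia.
exists w => //; split=> // i ir; exists (w i%:Z); last by exists i.
rewrite /w modz_small; last by lia.
rewrite /K; have -> : (i%:Z == 0) = false by lia.
exact: K0_low.
Qed.

(** Sorts the window with the type C generators, whatever the type at hand; [displacement] ensures
    termination. The result may violate the parity at [n]. *)
Lemma ascending_exists (n : nat) (w : int -> int) : (1 < n)%N -> mirrored n w ->
  exists v, [/\ mirrored n v, ascending n v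
    & forall b, in_window n v b <-> in_window n w b].
Proof.
move=> n1; have hn : (min_rank CC <= n)%N by []; elim/(@displacement_ind n): w => w IH wM.
have [wD|] := pselect (dominant CC n w).
  by have [wA|[]] := dominant_ascending hn wM wD; first by exists w.
move/(dominantPn wM)=> [i ir wi]; have /andP[_ ilen] := ir.
have gM := mirrored_gen hn ilen.
have [v [vM vA vw]] := IH _ (displacement_descent hn ilen wM wi) (mirrored_comp wM gM).
by exists v; split=> // b; rewrite vw in_window_gen.
Qed.

Lemma abacus_of_window (n : nat) (v w : int -> int) (A : set int) :
  mirrored n v -> (forall b, in_window n v b <-> in_window n w b) ->
  abacus_spec n w A -> abacus_of n v = A.
Proof.
move=> vM vw [Ae Af Al]; apply: (abacus_spec_uniq vM (abacus_ofP vM)).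
by split=> // i /Al[b b_low /vw bw]; exists b.
Qed.

Theorem lemma3p6 (X : qtype) (n : nat) (hn : (min_rank X <= n)%N) :
  set_bij (min_coset_reps X n) (abaci X n) (abacus_of n).
Proof.
have [n1 _ _ _] := min_rank_typeD hn; have n0 := ltnW n1.
split.
- by move=> w /(min_coset_repsP _ hn)[wG _]; apply: abacus_of_abaci.
- move=> v w /set_mem/(min_coset_repsP _ hn)[vG vD] /set_mem/(min_coset_repsP _ hn)[wG wD] vwA.
  have [vM _ _] := vG; have [wM _ _] := wG.
  apply: (dominant_uniq hn) => // b.
  by rewrite !in_window_abacus // vwA.
move=> A [Ae Af Ab A_even].
have [w0 w0M w0A] := mirrored_of_balanced Ae Af Ab.
have [w [wM wA ww0]] := ascending_exists n1 w0M.
have wE := abacus_of_window wM ww0 w0A.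
(* The parity at 0 can be read off the abacus. *)
have w_even0 : typeD_0 X -> even0 w.
  by rewrite -wE in A_even; case: X A_even {hn} => //= /(even_abacus_crossings wM).
(* The parity at [n] leaves no trace on the abacus: if it is wrong, [refl_n] corrects it, keeping
   the window and the parity at 0. *)
have [w_evenn|/not_implyP[D w_odd]] := pselect (typeD_n X -> evenn n w).
  exists w => //; apply/min_coset_repsP => //; split; first exact/affine_groupE.
  exact: ascending_dominant.
have rM : mirrored n (refl_n n) := mirrored_refl (refl_n_nondegenerate n0).
exists (w \o refl_n n); last first.
  apply: abacus_of_window (mirrored_comp wM rM) _ w0A => b.
  by rewrite in_window_refl_n.
apply/min_coset_repsP => //; split; last exact: ascending_dominant_refl_n.
apply/affine_groupE; split; first exact: mirrored_comp.
  by move=> /w_even0; rewrite even0_refl_n.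
by rewrite evenn_refl_n.
Qed.
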